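(* Let $\triangle$ be a regular triangulation of a polygonal domain $\Omega\subset\mathbb R^2$, let $r\ge1$ and $d\ge r+1$, and let $G_T$ denote the gradient matrix from $\mathcal P_d(T)$ to $[\mathcal P_{d-1}(T)]^2$ (in coefficients). On every edge $e$ of $T$, $$\Gamma^{(r-1)}_{e,T}G_T=\mathsf B^{(r)}_e\,\Gamma^{(r)}_{e,T},$$ where $\mathsf B^{(r)}_e$ has $2r$ block rows (numbered $1,\dots,2r$) and $r+1$ block columns (numbered $0,\dots,r$) and its only nonzero blocks are $$\bigl(\mathsf B^{(r)}_e\bigr)_{2m+1,\,m}=|e|^{-1}\mathsf U_{d-m},\qquad \bigl(\mathsf B^{(r)}_e\bigr)_{2m+2,\,m+1}=I,\qquad m=0,\dots,r-1.$$ Consequently $J_1^{(r-1)}D_0^{\mathrm{br}}=B_0^{(r)}J_0^{(r)}$ with $B_0^{(r)}=\operatorname{diag}_e\mathsf B_e^{(r)}$ (over interior edges), and $\nabla S^r_d(\triangle)\subset[S^{r-1}_{d-1}(\triangle)]^2$. In the same way, for the curl matrix $D_{1,T}:[\mathcal P_{d-1}(T)]^2\to\mathcal P_{d-2}(T)$, $$\Gamma^{(r-2)}_{e,T}D_{1,T}=\mathsf B^{(r-1)}_{e,\mathrm{curl}}\,\Gamma^{(r-1)}_{e,T},$$ where the only nonzero blocks of $\mathsf B^{(r-1)}_{e,\mathrm{curl}}$ (block rows numbered $0,\dots,r-2$, block columns numbered $1,\dots,2r$) are $$\bigl(\mathsf B^{(r-1)}_{e,\mathrm{curl}}\bigr)_{m,\,2m+2}=|e|^{-1}\mathsf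 U_{d-1-m},\qquad \bigl(\mathsf B^{(r-1)}_{e,\mathrm{curl}}\bigr)_{m,\,2m+3}=-I,\qquad m=0,\dots,r-2,$$ and the sequence $$S^r_d(\triangle)\xrightarrow{\nabla}[S^{r-1}_{d-1}(\triangle)]^2\xrightarrow{\mathrm{curl}}S^{r-2}_{d-2}(\triangle)$$ is a subcomplex (each map sends its space into the next one and the composition is zero) with edge-local factors, i.e. the commuting factors for both differential operators are block diagonal over interior edges.
   Context: Triangulation: $\triangle$ is a finite set of nondegenerate closed triangles whose union is $\overline\Omega$, with $\Omega$ the (connected) interior of that union; any two distinct triangles meet in the empty set, a common vertex, or a common edge. An interior edge is an edge shared by two triangles $T^+,T^-$. $\mathcal P_m(T)$ is the space of polynomials of total degree at most $m$ on $T$, represented by Bernstein coefficients on $T$. $S^r_m(\triangle)=\{s\in C^r(\Omega):s|_T\in\mathcal P_m(T)\ \forall T\}$ for $r\ge0$; for negative superscript the space consists of discontinuous piecewise polynomials (families $(s|_T)_T$). $D_0^{\mathrm{br}}$ and $D_1$ are the triangle-by-triangle gradient and curl on discontinuous piecewise polynomials, with local blocks $G_T$ and $D_{1,T}$; $\mathrm{curl}\,v=\partial_xv^y-\partial_yv^x$. Each edge $e$ has length $|e|$ and a fixed orientation with unit tangent $t_e$ pointing from its first endpoint $a$ to its second endpoint $b$, and unit normal $n_e=Rt_e$, $R(a_1,a_2)=(-a_2,a_1)$. The degree-$m$ coefficient vector on $e$ of a polynomial $p$ is $(r_0,\dots,r_m)$ with $p(a+t(b-a))=\sum_j r_j\binom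 mj t^j(1-t)^{m-j}$. For a scalar polynomial $s$ on $T$ of degree $m_0$ (the degree of its space), $\gamma_m(s)\in\mathbb R^{m_0+1-m}$ is the degree-$(m_0-m)$ coefficient vector on $e$ of $D_{n_e}^ms$, where $D_{n_e}$ is the derivative in direction $n_e$. For scalars, $\Gamma^{(r)}_{e,T}$ maps the coefficients of $s$ to $(\gamma_0(s),\dots,\gamma_r(s))$ (block index $0,\dots,r$). For a vector polynomial $v$ on $T$ put $v_t=v\cdot t_e$, $v_n=v\cdot n_e$; then $\Gamma^{(r-1)}_{e,T}$ maps its coefficients to $(\gamma_0(v_t),\gamma_0(v_n),\dots,\gamma_{r-1}(v_t),\gamma_{r-1}(v_n))$ (block index $1,\dots,2r$). In the first identity $\Gamma^{(r)}_{e,T}$ acts on scalars of degree $d$ and $\Gamma^{(r-1)}_{e,T}$ on vector fields of degree $d-1$; in the curl identity $\Gamma^{(r-2)}_{e,T}$ acts on scalars of degree $d-2$ (and is empty for $r=1$). For an interior edge, the jump functionals are $J^{(r)}_{0,e}=[\Gamma^{(r)}_{e,T^+}\ \ -\Gamma^{(r)}_{e,T^-}]$ on scalars and $J^{(r-1)}_{1,e}=[\Gamma^{(r-1)}_{e,T^+}\ \ -\Gamma^{(r-1)}_{e,T^-}]$ on vector fields; $J_0^{(r)}$, $J_1^{(r-1)}$ are their stacks over interior edges. $\mathsf U_m\in\mathbb R^{m\times(m+1)}$ is the matrix with $(\mathsf U_m r)_j=m(r_{j+1}-r_j)$, $j=0,\dots,m-1$. *)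

(* Defs.v *)
From HB Require Import structures.
From mathcomp Require Import all_boot all_order all_algebra.
From mathcomp Require Import all_classical all_reals all_analysis.
Set Implicit Arguments.
Unset Strict Implicit.
Unset Printing Implicit Defensive.
Import Order.TTheory GRing.Theory Num.Theory.
Import numFieldNormedType.Exports.
Local Open Scope classical_set_scope.
Local Open Scope ring_scope.

Section Plane.
Context {R : realType}.
Implicit Types (u v w a b x : 'rV[R]_2).

Definition ex : 'rV[R]_2 := delta_mx 0 0.
Definition ey : 'rV[R]_2 := delta_mx 0 1.
Definition dot u v : R := \sum_(i < 2) u 0 i * v 0 i.
Definition det2 u v : R := u 0 0 * v 0 1 - u 0 1 * v 0 0.
Definition rot v : 'rV[R]_2 := v 0 0 *: ey - v 0 1 *: ex.

(* The norm of the library on ['rV_2] is the sup norm, hence [Num.sqrt]. *)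
Definition elen a b : R := Num.sqrt (dot (b - a) (b - a)).
Definition tangent a b := (elen a b)^-1 *: (b - a).
Definition normal a b := rot (tangent a b).

Definition seg a b : set 'rV[R]_2 :=
  [set x | exists t : R, [/\ 0 <= t, t <= 1 & x = a + t *: (b - a)]].

Definition grad (f : 'rV[R]_2 -> R) : 'rV[R]_2 -> 'rV[R]_2 :=
  fun x => 'D_ex f x *: ex + 'D_ey f x *: ey.

Definition curl (v : 'rV[R]_2 -> 'rV[R]_2) : 'rV[R]_2 -> R :=
  fun x => 'D_ex (fun y => v y 0 1) x - 'D_ey (fun y => v y 0 0) x.

Fixpoint Cr (n : nat) (U : set 'rV[R]_2) (f : 'rV[R]_2 -> R) : Prop :=
  (forall x, U x -> {for x, continuous f}) /\
  (if n is n'.+1 then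
     [/\ forall x, U x -> derivable f x ex /\ derivable f x ey,
         Cr n' U (fun x => 'D_ex f x) & Cr n' U (fun x => 'D_ey f x)]
   else True).

(* Polynomials of total degree at most [m], as functions on the whole plane
   (a polynomial on a nondegenerate triangle extends uniquely). *)
Definition is_poly (m : nat) (p : 'rV[R]_2 -> R) : Prop :=
  exists c : nat -> nat -> R, forall x,
    p x = \sum_(i < m.+1) \sum_(j < m.+1 | (i + j <= m)%N)
            c i j * x 0 0 ^+ i * x 0 1 ^+ j.

Definition is_vpoly (m : nat) (v : 'rV[R]_2 -> 'rV[R]_2) : Prop :=
  forall k, is_poly m (fun x => v x 0 k).

End Plane.

Section Triangulation.
Context {R : realType}.
Local Notation triangle := ('I_3 -> 'rV[R]_2).

Definition nondegenerate (T : triangle) : Prop :=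
  det2 (T 1 - T 0) (T (1 + 1) - T 0) != 0.

Definition closed_triangle (T : triangle) : set 'rV[R]_2 :=
  [set x | exists l : 'I_3 -> R,
    [/\ forall i, 0 <= l i, \sum_i l i = 1 & x = \sum_i l i *: T i]].

(* The segment [a, b] is an edge of [T]; both orientations are allowed. *)
Definition edge (T : triangle) (a b : 'rV[R]_2) : Prop :=
  exists k l : 'I_3, [/\ k != l, a = T k & b = T l].

Definition domain N (tri : 'I_N -> triangle) : set 'rV[R]_2 :=
  interior (\bigcup_i closed_triangle (tri i)).

Definition triangulation N (tri : 'I_N -> triangle) : Prop :=
  [/\ forall i, nondegenerate (tri i),
      closure (domain tri) = \bigcup_i closed_triangle (tri i),
      connected (domain tri) &
      forall i j, i != j ->
        let I := closed_triangle (tri i) `&` closed_triangle (tri j) in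
        [\/ I = set0,
            exists k l : 'I_3, tri i k = tri j l /\ I = [set tri i k] |
            exists a b, [/\ edge (tri i) a b, edge (tri j) a b & I = seg a b]]].

(* An enumeration without repetition of the interior edges; it fixes for each
   edge its endpoints [src], [tgt] (in this order) and the naming T+, T- of its
   two triangles. *)
Definition interior_edges N (tri : 'I_N -> triangle) nE
    (src tgt : 'I_nE -> 'rV[R]_2) (Tp Tm : 'I_nE -> 'I_N) : Prop :=
  [/\ forall e, [/\ Tp e != Tm e, edge (tri (Tp e)) (src e) (tgt e)
                  & edge (tri (Tm e)) (src e) (tgt e)],
      forall i j a b, i != j -> edge (tri i) a b -> edge (tri j) a b ->
        exists e, (src e = a /\ tgt e = b) \/ (src e = b /\ tgt e = a) &
      forall e e', (src e = src e' /\ tgt e = tgt e') \/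
                   (src e = tgt e' /\ tgt e = src e') -> e = e'].

End Triangulation.

Section Matrices.
Context {R : realType}.
Local Notation triangle := ('I_3 -> 'rV[R]_2).

(* Coefficients of [f] in the linearly independent family [b]; only used for
   [f] in the span of [b], where they are unique (0 outside the span). *)
Definition coefs (X : Type) (W : lmodType R) n (b : 'I_n -> X -> W)
    (f : X -> W) : 'cV[R]_n :=
  xget 0 [set c : 'cV[R]_n | forall x, f x = \sum_i c i 0 *: b i x].

(* Matrix of the linear operator [L] with respect to the bases [b], [b'],
   acting on columns of coefficients. *)
Definition op_mx (X Y : Type) (V W : lmodType R) n n'
    (b : 'I_n -> X -> V) (b' : 'I_n' -> Y -> W)
    (L : (X -> V) -> (Y -> W)) : 'M[R]_(n', n) :=
  \matrix_(i, j) coefs b' (L (b j)) i 0.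

Definition bern1 n (j : 'I_n.+1) (t : R) : R^o :=
  'C(n, j)%:R * t ^+ j * (1 - t) ^+ (n - j).

(* Barycentric coordinates as ratios of signed areas; indices are mod 3. *)
Definition bary (T : triangle) (i : 'I_3) (x : 'rV[R]_2) : R :=
  det2 (T (i + 1) - x) (T (i + 1 + 1) - x) /
  det2 (T (i + 1) - T i) (T (i + 1 + 1) - T i).

Definition midx m : {set {ffun 'I_3 -> 'I_m.+1}} :=
  [set al : {ffun 'I_3 -> 'I_m.+1} | (\sum_i al i == m)%N]%SET.

Definition bern2 (T : triangle) m (k : 'I_#|midx m|) (x : 'rV[R]_2) : R^o :=
  let al := enum_val k in
  m`!%:R / (\prod_i (al i)`!)%:R * \prod_i bary T i x ^+ al i.

(* Vector fields: all x-coefficients first, then all y-coefficients. *)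
Definition vbern2 (T : triangle) m (k : 'I_(#|midx m| + #|midx m|))
    (x : 'rV[R]_2) : 'rV[R]_2 :=
  match fintype.split k with
  | inl i => bern2 T i x *: ex
  | inr i => bern2 T i x *: ey
  end.

Definition G_mx (T : triangle) d :
    'M[R]_(#|midx d.-1| + #|midx d.-1|, #|midx d|) :=
  op_mx (bern2 T (m:=d)) (vbern2 T (m:=d.-1)) grad.

Definition curl_mx (T : triangle) m :
    'M[R]_(#|midx m.-1|, #|midx m| + #|midx m|) :=
  op_mx (vbern2 T (m:=m)) (bern2 T (m:=m.-1)) curl.

(* t |-> (D_{n_e}^m s) (a + t (b - a)) *)
Definition normal_der (a b : 'rV[R]_2) (m : nat) (s : 'rV[R]_2 -> R)
    (t : R) : R :=
  iter m (fun (f : 'rV[R]_2 -> R) x => 'D_(normal a b) f x) s (a + t *: (b - a)).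

Definition gamma_s (T : triangle) (a b : 'rV[R]_2) m0 m :
    'M[R]_((m0 - m).+1, #|midx m0|) :=
  op_mx (bern2 T (m:=m0)) (@bern1 (m0 - m)) (normal_der a b m).

(* gamma_m of the component of a vector field along [w] *)
Definition gamma_v (w : 'rV[R]_2) (T : triangle) (a b : 'rV[R]_2) m0 m :
    'M[R]_((m0 - m).+1, #|midx m0| + #|midx m0|) :=
  op_mx (vbern2 T (m:=m0)) (@bern1 (m0 - m))
    (fun v => normal_der a b m (fun x => dot (v x) w)).

(* In [Gamma_s k], [Gamma_v k] the number [k] of normal orders 0, ..., k-1 is
   the superscript of Gamma plus one: [Gamma_s r.+1] is Gamma^(r) and
   [Gamma_s r.-1] is Gamma^(r-2), empty for r = 1. *)
Definition Gamma_s (T : triangle) (a b : 'rV[R]_2) m0 k :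
    'M[R]_(\sum_(i < k) (m0 - i).+1, #|midx m0|) :=
  \mxcol_(i < k) gamma_s T a b m0 i.

(* Blocks are numbered from 0 here: block [2m] is gamma_m (v_t) and block
   [2m+1] is gamma_m (v_n). *)
Definition Gamma_v (T : triangle) (a b : 'rV[R]_2) m0 k :
    'M[R]_(\sum_(i < k.*2) (m0 - i./2).+1, #|midx m0| + #|midx m0|) :=
  \mxcol_(i < k.*2)
    gamma_v (if odd i then normal a b else tangent a b) T a b m0 i./2.

Definition U_mx m : 'M[R]_(m, m.+1) :=
  \matrix_(i, j) (m%:R * ((j == i.+1 :> nat)%:R - (j == i :> nat)%:R)).

(* [conform_mx 0] only recasts dimensions such as [d - m = (d.-1 - m).+1]. The
   block row [i] (numbered from 0) is the block row of number [i + 1]. *)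
Definition B_mx (a b : 'rV[R]_2) r d :
    'M[R]_(\sum_(i < r.*2) (d.-1 - i./2).+1, \sum_(j < r.+1) (d - j).+1) :=
  \mxblock_(i < r.*2, j < r.+1)
    (if ~~ odd i && (j == i./2 :> nat)
     then (elen a b)^-1 *: conform_mx 0 (U_mx (d - j))
     else if odd i && (j == i./2.+1 :> nat)
     then conform_mx 0 (1%:M : 'M[R]_((d - j).+1))
     else 0).

(* Block columns are numbered from 0: column [j] has number [j + 1]. *)
Definition Bcurl_mx (a b : 'rV[R]_2) r d :
    'M[R]_(\sum_(i < r.-1) (d.-2 - i).+1, \sum_(j < r.*2) (d.-1 - j./2).+1) :=
  \mxblock_(i < r.-1, j < r.*2)
    (if j == i.*2.+1 :> nat
     then (elen a b)^-1 *: conform_mx 0 (U_mx (d.-1 - i))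
     else if j == i.*2.+2 :> nat
     then - conform_mx 0 (1%:M : 'M[R]_((d.-1 - j./2).+1))
     else 0).

(* block diagonal matrix with rectangular blocks *)
Definition blockdiag n p q (A : 'I_n -> 'M[R]_(p, q)) :
    'M[R]_(\sum_(i < n) p, \sum_(j < n) q) :=
  \mxblock_(i < n, j < n) (if i == j then A i else 0).

(* Stack over the interior edges [e] of the rows [Ge, - Ge'] with [Ge] in the
   columns of T+ and [Ge'] in those of T-. *)
Definition jump_mx N nE p q (Tp Tm : 'I_nE -> 'I_N)
    (G : 'I_nE -> 'I_N -> 'M[R]_(p, q)) :
    'M[R]_(\sum_(e < nE) p, \sum_(i < N) q) :=
  \mxblock_(e < nE, i < N)
    (if i == Tp e then G e i else if i == Tm e then - G e i else 0).

Section Global.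
Variables (N nE : nat) (tri : 'I_N -> triangle).
Variables (src tgt : 'I_nE -> 'rV[R]_2) (Tp Tm : 'I_nE -> 'I_N).

Definition jump_s m0 k :=
  jump_mx Tp Tm (fun e i => Gamma_s (tri i) (src e) (tgt e) m0 k).
Definition jump_v m0 k :=
  jump_mx Tp Tm (fun e i => Gamma_v (tri i) (src e) (tgt e) m0 k).
Definition D0_mx d := blockdiag (fun i => G_mx (tri i) d).
Definition D1_mx m := blockdiag (fun i => curl_mx (tri i) m).
Definition B0_mx r d := blockdiag (fun e => B_mx (src e) (tgt e) r d).
Definition B1_mx r d := blockdiag (fun e => Bcurl_mx (src e) (tgt e) r d).
End Global.
End Matrices.

Section Splines.
Context {R : realType} (N : nat) (tri : 'I_N -> 'I_3 -> 'rV[R]_2).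
Local Notation Omega := (domain tri).

Definition agree W (s : 'rV[R]_2 -> W) (u : 'I_N -> 'rV[R]_2 -> W) : Prop :=
  forall i x, closed_triangle (tri i) x -> Omega x -> s x = u i x.

(* S^n_m for n >= 0 as a space of functions on the domain (the values of [s]
   outside the domain are irrelevant). *)
Definition spline_fun (n m : nat) (s : 'rV[R]_2 -> R) : Prop :=
  Cr n Omega s /\
  exists u : 'I_N -> 'rV[R]_2 -> R, (forall i, is_poly m (u i)) /\ agree s u.

Definition vspline_fun (n m : nat) (v : 'rV[R]_2 -> 'rV[R]_2) : Prop :=
  forall k, spline_fun n m (fun x => v x 0 k).

(* S^k_m for any integer k, a spline being given by the family of its
   polynomial pieces. *)
Definition spline (k : int) (m : nat) (u : 'I_N -> 'rV[R]_2 -> R) : Prop :=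
  (forall i, is_poly m (u i)) /\
  (if k is Posz n then exists s, Cr n Omega s /\ agree s u else True).

Definition vspline (k : int) (m : nat) (v : 'I_N -> 'rV[R]_2 -> 'rV[R]_2) :
    Prop :=
  forall j, spline k m (fun i x => v i x 0 j).

Definition bgrad (u : 'I_N -> 'rV[R]_2 -> R) i := grad (u i).
Definition bcurl (v : 'I_N -> 'rV[R]_2 -> 'rV[R]_2) i := curl (v i).

End Splines.

(* Main.v *)
(* Directional derivatives of polynomials commute and satisfy
   D_t = |e|^-1 D_{b-a} for the unit tangent t of an edge [a, b]. With v = grad s
   this gives D_n^m v_t = D_t D_n^m s and D_n^m v_n = D_n^(m+1) s, and along the
   edge D_{b-a} is d/dt, that is U on Bernstein coefficients. For the curl one
   uses curl v = D_t v_n - D_n v_t in the frame (t, n). Uniqueness of coefficients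
   is only needed for the univariate Bernstein basis, the bivariate one has to be
   spanning. For splines, s coincides near every point of an open triangle with
   its polynomial piece; derivatives of both are continuous, so they agree on the
   whole triangle as far as it lies in the domain. *)

Require Import Defs.
From mathcomp Require Import all_boot all_order all_algebra.
From mathcomp Require Import all_classical all_reals all_analysis.
From mathcomp Require Import ring zify.
Import Order.TTheory GRing.Theory Num.Theory.
Import numFieldNormedType.Exports.
Local Open Scope classical_set_scope.
Local Open Scope ring_scope.
Set Implicit Arguments.
Unset Strict Implicit.

Lemma ord2P (k : 'I_2) : k = 0 \/ k = 1.
Proof. by case: k => [[|[|//]] kp]; [left|right]; apply/val_inj. Qed.

Lemma ord3P (i : 'I_3) : [\/ i = 0, i = 1 | i = 1 + 1].
Proof.
by case: i => [[|[|[|//]]] ip]; [apply: Or31|apply: Or32|apply: Or33];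
  apply/val_inj.
Qed.

(** * Bivariate polynomials *)

Section BivariatePolynomials.
Context {R : realType}.
Local Notation plane := 'rV[R]_2.
Implicit Types (p q f g : plane -> R) (v w x : plane) (m n : nat).

Definition mono (c : R) i j : plane -> R :=
  fun x => c * x 0 0 ^+ i * x 0 1 ^+ j.

Lemma sum_closed (Q : (plane -> R) -> Prop) I (s : seq I) (P : pred I)
    (F : I -> plane -> R) :
  Q (fun=> 0) -> (forall f g, Q f -> Q g -> Q (fun x => f x + g x)) ->
  (forall i, P i -> Q (F i)) -> Q (fun x => \sum_(i <- s | P i) F i x).
Proof.
move=> Q0 QD QF; elim: s => [|i s IHs].
  by rewrite (_ : (fun _ => _) = fun=> 0)//; apply/funext => x; rewrite big_nil.
have [Pi|nPi] := boolP (P i).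
  rewrite (_ : (fun _ => _) = fun x => F i x + \sum_(i <- s | P i) F i x).
    exact: QD (QF _ Pi) IHs.
  by apply/funext => x; rewrite big_cons Pi.
rewrite (_ : (fun _ => _) = fun x => \sum_(i <- s | P i) F i x)//.
by apply/funext => x; rewrite big_cons (negbTE nPi).
Qed.

Lemma is_poly_ind m (Q : (plane -> R) -> Prop) :
  (forall c i j, (i + j <= m)%N -> Q (mono c i j)) ->
  (forall f g, Q f -> Q g -> Q (fun x => f x + g x)) ->
  forall p, is_poly m p -> Q p.
Proof.
move=> Qm QD p [c pE].
have Q0 : Q (fun=> 0).
  rewrite (_ : (fun _ => _) = mono 0 0 0); first exact: Qm.
  by apply/funext => x; rewrite /mono !mul0r.
rewrite (_ : p = fun x => \sum_(i < m.+1) \sum_(j < m.+1 | (i + j <= m)%N)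
   mono (c i j) i j x); last exact/funext.
apply: sum_closed => // i _; apply: sum_closed => // j; exact: Qm.
Qed.

Lemma is_poly_mono m c i j : (i + j <= m)%N -> is_poly m (mono c i j).
Proof.
move=> ij; exists (fun k l => if (k == i) && (l == j) then c else 0) => x.
have im : (i < m.+1)%N by lia.
have jm : (j < m.+1)%N by lia.
rewrite (bigD1 (Ordinal im))//= [X in _ + X]big1 ?addr0; last first.
  move=> k; rewrite -val_eqE /= => /negbTE ->.
  by rewrite big1// => l _; rewrite /= !mul0r.
rewrite (bigD1 (Ordinal jm))//= !eqxx /= [X in _ + X]big1 ?addr0//.
by move=> k /andP[_]; rewrite -val_eqE /= => /negbTE ->; rewrite !mul0r.
Qed.

Lemma is_polyD m f g :
  is_poly m f -> is_poly m g -> is_poly m (fun x => f x + g x).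
Proof.
move=> [c fE] [e gE]; exists (fun i j => c i j + e i j) => x.
rewrite fE gE -big_split; apply: eq_bigr => i _; rewrite -big_split.
by apply: eq_bigr => j _ /=; rewrite !mulrDl.
Qed.

Lemma is_polyZ m a f : is_poly m f -> is_poly m (fun x => a * f x).
Proof.
move=> [c fE]; exists (fun i j => a * c i j) => x.
rewrite fE mulr_sumr; apply: eq_bigr => i _; rewrite mulr_sumr.
by apply: eq_bigr => j _; rewrite !mulrA.
Qed.

Lemma is_polyN m f : is_poly m f -> is_poly m (fun x => - f x).
Proof.
move=> /(is_polyZ (-1)); rewrite (_ : (fun _ => _) = fun x => - f x)//.
by apply/funext => x; rewrite mulN1r.
Qed.

Lemma is_poly_cst m c : is_poly m ((fun=> c) : plane -> R).
Proof.
rewrite (_ : (fun _ => _) = mono c 0 0); first exact: is_poly_mono.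
by apply/funext => x; rewrite /mono !mulr1.
Qed.

Lemma is_polyM m n f g :
  is_poly m f -> is_poly n g -> is_poly (m + n) (fun x => f x * g x).
Proof.
move=> fP gP; move: f fP; apply: is_poly_ind => [c i j ij|f1 f2 P1 P2]; last first.
  rewrite (_ : (fun _ => _) = fun x => f1 x * g x + f2 x * g x).
    exact: is_polyD.
  by apply/funext => x; rewrite mulrDl.
move: g gP; apply: is_poly_ind => [e k l kl|f1 f2 P1 P2]; last first.
  rewrite (_ : (fun _ => _) = fun x => mono c i j x * f1 x + mono c i j x * f2 x).
    exact: is_polyD.
  by apply/funext => x; rewrite mulrDr.
rewrite (_ : (fun _ => _) = mono (c * e) (i + k) (j + l)).
  by apply: is_poly_mono; lia.
by apply/funext => x; rewrite /mono !exprD; ring.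
Qed.

Lemma is_poly_sum m I (s : seq I) (P : pred I) (F : I -> plane -> R) :
  (forall i, P i -> is_poly m (F i)) ->
  is_poly m (fun x => \sum_(i <- s | P i) F i x).
Proof. by apply: sum_closed; [exact: is_poly_cst|exact: is_polyD]. Qed.

Lemma is_polyX n f : is_poly 1 f -> is_poly n (fun x => f x ^+ n).
Proof.
move=> fP; elim: n => [|n IHn]; first exact: is_poly_cst.
rewrite (_ : (fun _ => _) = fun x => f x * f x ^+ n); first exact: (is_polyM fP).
by apply/funext => x; rewrite exprS.
Qed.

Lemma is_poly_affine m (c0 c1 c2 : R) : (0 < m)%N ->
  is_poly m (fun x : plane => c0 + c1 * x 0 0 + c2 * x 0 1).
Proof.
move=> m0; apply: is_polyD; first apply: is_polyD.
- exact: is_poly_cst.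
- rewrite (_ : (fun _ => _) = mono c1 1 0); first exact: is_poly_mono.
  by apply/funext => x; rewrite /mono expr1 mulr1.
- rewrite (_ : (fun _ => _) = mono c2 0 1); first exact: is_poly_mono.
  by apply/funext => x; rewrite /mono expr1 mulr1.
Qed.

Lemma is_poly_continuous m p : is_poly m p -> continuous p.
Proof.
move: p; apply: is_poly_ind => [c i j _|f g fc gc] x; last first.
  exact: (cvgD (fc x) (gc x)).
have cX (k : 'I_2) n : (fun y : plane => y 0 k ^+ n : R) @ x --> (x : plane) 0 k ^+ n.
  exact: (cvg_comp (fun y : plane => y 0 k : R) (fun t : R => t ^+ n)
    (@coord_continuous R _ _ 0 k x) (@exprn_continuous R n _)).
exact: (cvgM (cvgM (cvg_cst c) (cX 0 i)) (cX 1 j)).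
Qed.

Lemma is_derive_coord (x v : plane) (k : 'I_2) :
  is_derive x v (fun y : plane => y 0 k) (v 0 k).
Proof.
suff H : (fun h : R => h^-1 *: (((fun y : plane => y 0 k) \o shift x) (h *: v)
    - x 0 k)) @ 0^' --> v 0 k.
  by split; [apply: cvgP H|apply: cvg_lim H].
apply: cvg_near_cst; near=> h; rewrite /= !mxE addrK /GRing.scale /= mulrA mulVf ?mul1r//.
by near: h; exact: nbhs_dnbhs_neq.
Unshelve. all: end_near. Qed.

Lemma is_derive_mono c i j (x v : plane) :
  is_derive x v (mono c i j)
    (v 0 0 * mono (c *+ i) i.-1 j x + v 0 1 * mono (c *+ j) i j.-1 x).
Proof.
have d0 := is_derive_coord x v 0; have d1 := is_derive_coord x v 1.
have dX k n : is_derive x v (fun y : plane => y 0 k) (v 0 k) ->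
    is_derive x v (fun y : plane => y 0 k ^+ n)
      ((x 0 k ^+ n.-1 *+ n) * v 0 k).
  move=> dk; have := is_deriveX n dk; rewrite exprfctE => H.
  by apply: is_derive_eq H _; rewrite /GRing.scale /= mulr_natl.
have H := is_deriveM (is_deriveZ c (dX _ i d0)) (dX _ j d1).
rewrite (_ : _ * _ = mono c i j) in H; last first.
  by apply/funext => y; rewrite /mono.
apply: is_derive_eq H _.
rewrite /mono /GRing.scale /= /GRing.scale /=.
by rewrite -[(x 0 1 ^+ _) *+ _]mulr_natl -[(x 0 0 ^+ _) *+ _]mulr_natl
  -[c *+ i]mulr_natl -[c *+ j]mulr_natl; ring.
Qed.

(* Locked, since unification would otherwise compare directional derivatives by
   unfolding limits. *)
Fact D_key : unit. Proof. exact: tt. Qed.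
Definition D : plane -> (plane -> R) -> plane -> R :=
  locked_with D_key (fun v f => 'D_v f).

Lemma DE v f : D v f = 'D_v f.
Proof. by rewrite /D unlock. Qed.

Lemma derive_mono c i j (v : plane) : D v (mono c i j) =
  fun x => v 0 0 * mono (c *+ i) i.-1 j x + v 0 1 * mono (c *+ j) i j.-1 x.
Proof.
by rewrite DE; apply/funext => x; exact: (@derive_val _ _ _ _ _ _ _ (is_derive_mono c i j x v)).
Qed.

Lemma ex00 : (ex : plane) 0 0 = 1. Proof. by rewrite mxE. Qed.
Lemma ex01 : (ex : plane) 0 1 = 0. Proof. by rewrite mxE. Qed.
Lemma ey00 : (ey : plane) 0 0 = 0. Proof. by rewrite mxE. Qed.
Lemma ey01 : (ey : plane) 0 1 = 1. Proof. by rewrite mxE. Qed.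

Lemma derive_ex_mono c i j : D ex (mono c i j) = mono (c *+ i) i.-1 j.
Proof. by rewrite derive_mono ex00 ex01; apply/funext => x; rewrite mul1r mul0r addr0. Qed.

Lemma derive_ey_mono c i j : D ey (mono c i j) = mono (c *+ j) i j.-1.
Proof. by rewrite derive_mono ey00 ey01; apply/funext => x; rewrite mul1r mul0r add0r. Qed.

Lemma is_poly_derivable m p x v : is_poly m p -> derivable p x v.
Proof.
move: p; apply: is_poly_ind => [c i j _|f g fd gd]; last exact: derivableD.
by apply: ex_derive; exact: is_derive_mono.
Qed.

Lemma poly_deriveD m n f g v : is_poly m f -> is_poly n g ->
  D v (fun x => f x + g x) = fun x => D v f x + D v g x.
Proof.
by move=> fP gP; rewrite !DE; apply/funext => x; apply: deriveD; apply: is_poly_derivable; eauto.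
Qed.

Lemma poly_deriveZ m a f v : is_poly m f ->
  D v (fun x => a * f x) = fun x => a * D v f x.
Proof.
by move=> fP; rewrite !DE; apply/funext => x; apply: deriveZ; apply: is_poly_derivable; eauto.
Qed.

Lemma poly_deriveE m p v : is_poly m p ->
  D v p = fun x => v 0 0 * D ex p x + v 0 1 * D ey p x.
Proof.
move=> pP; suff [] : is_poly m p /\
  D v p = fun x => v 0 0 * D ex p x + v 0 1 * D ey p x by [].
move: p pP; apply: is_poly_ind => [c i j ij|f g [fP fE] [gP gE]].
  by split; [exact: is_poly_mono|rewrite derive_ex_mono derive_ey_mono derive_mono].
split; first exact: is_polyD.
rewrite !(poly_deriveD _ fP gP) fE gE.
by apply/funext => x; rewrite !mulrDr addrACA.
Qed.

Lemma is_poly_derive m p v : is_poly m p -> is_poly m.-1 (D v p).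
Proof.
move=> pP; suff [] : is_poly m p /\ is_poly m.-1 (D v p) by [].
move: p pP; apply: is_poly_ind => [c i j ij|f g [fP fE] [gP gE]]; last first.
  by split; [exact: is_polyD|rewrite (poly_deriveD _ fP gP); exact: is_polyD].
split; first exact: is_poly_mono.
rewrite derive_mono; apply: is_polyD; apply: is_polyZ.
- case: i ij => [|i] ij; last by apply: is_poly_mono; lia.
  by rewrite (_ : mono _ _ _ = fun=> 0); [exact: is_poly_cst
    |apply/funext => x; rewrite /mono !mul0r].
- case: j ij => [|j] ij; last by apply: is_poly_mono; lia.
  by rewrite (_ : mono _ _ _ = fun=> 0); [exact: is_poly_cst
    |apply/funext => x; rewrite /mono !mul0r].
Qed.

Lemma poly_derive_exy m p : is_poly m p -> D ex (D ey p) = D ey (D ex p).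
Proof.
move=> pP; suff [] : is_poly m p /\ D ex (D ey p) = D ey (D ex p) by [].
move: p pP; apply: is_poly_ind => [c i j ij|f g [fP fE] [gP gE]]; last first.
  split; first exact: is_polyD.
  rewrite !(poly_deriveD _ fP gP).
  by rewrite !(poly_deriveD _ (is_poly_derive _ fP) (is_poly_derive _ gP)) fE gE.
split; first exact: is_poly_mono.
by rewrite !(derive_ex_mono, derive_ey_mono) mulrnAC.
Qed.

Lemma poly_deriveC m p v w : is_poly m p -> D v (D w p) = D w (D v p).
Proof.
move=> pP; have dP u := is_poly_derive u pP.
have E u u' : D u (D u' p) = fun x => u' 0 0 * D u (D ex p) x
     + u' 0 1 * D u (D ey p) x.
  rewrite {1}(poly_deriveE u' pP).
  by rewrite (poly_deriveD _ (is_polyZ _ (dP _)) (is_polyZ _ (dP _)))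
    !(poly_deriveZ _ _ (dP _)).
rewrite E (E w v) (poly_deriveE v (dP ex)) (poly_deriveE v (dP ey)).
rewrite (poly_deriveE w (dP ex)) (poly_deriveE w (dP ey)) (poly_derive_exy pP).
apply/funext => x; move: (D ex _ x) (D ey (D ex p) x) (D ey _ x) => A B C.
by ring.
Qed.

Lemma poly_deriveZv m p (a : R) v : is_poly m p ->
  D (a *: v) p = fun x => a * D v p x.
Proof.
move=> pP; rewrite (poly_deriveE _ pP) (poly_deriveE v pP); apply/funext => x.
by rewrite !mxE; ring.
Qed.

Definition Diter v n p := iter n (D v) p.

Lemma is_poly_Diter m p v n : is_poly m p -> is_poly (m - n) (Diter v n p).
Proof.
move=> pP; elim: n => [|n IHn]; first by rewrite subn0.
by rewrite subnS; exact: is_poly_derive.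
Qed.

Lemma Diter_derive m p v w n : is_poly m p ->
  Diter v n (D w p) = D w (Diter v n p).
Proof.
move=> pP; elim: n => //= n ->.
exact: (poly_deriveC _ _ (is_poly_Diter v n pP)).
Qed.

Lemma DiterD m f g v n : is_poly m f -> is_poly m g ->
  Diter v n (fun x => f x + g x) = fun x => Diter v n f x + Diter v n g x.
Proof.
move=> fP gP; elim: n => //= n ->.
exact: (poly_deriveD _ (is_poly_Diter _ _ fP) (is_poly_Diter _ _ gP)).
Qed.

Lemma DiterZ m a f v n : is_poly m f ->
  Diter v n (fun x => a * f x) = fun x => a * Diter v n f x.
Proof.
move=> fP; elim: n => //= n ->.
exact: (poly_deriveZ _ _ (is_poly_Diter _ _ fP)).
Qed.

Lemma is_poly_line m p (a w : plane) : is_poly m p ->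
  exists q : {poly R}, [/\ (size q <= m.+1)%N,
    forall t, p (a + t *: w) = q.[t] &
    forall t, D w p (a + t *: w) = q^`().[t]].
Proof.
move=> pP; suff [] : is_poly m p /\ exists q : {poly R}, [/\ (size q <= m.+1)%N,
    forall t, p (a + t *: w) = q.[t] &
    forall t, D w p (a + t *: w) = q^`().[t]] by [].
move: p pP; apply: is_poly_ind => [c i j ij|f g [fP [q [sq qE dq]]] [gP [s [ss sE ds]]]]; last first.
  split; first exact: is_polyD.
  exists (q + s); split => [|t|t].
  - by rewrite (leq_trans (size_polyD _ _))// geq_max sq ss.
  - by rewrite qE sE hornerD.
  - by rewrite (poly_deriveD _ fP gP) dq ds derivD hornerD.
split; first exact: is_poly_mono.
pose l k : {poly R} := (a 0 k)%:P + (w 0 k) *: 'X.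
have sl k n : (size (l k ^+ n) <= n.+1)%N.
  have : (size (l k) <= 2)%N.
    rewrite (leq_trans (size_polyD _ _))// geq_max.
    rewrite (leq_trans (size_polyC_leq1 _))//.
    by rewrite (leq_trans (size_scale_leq _ _))// size_polyX.
  by move=> H; rewrite (leq_trans (size_poly_exp_leq _ _)) //; nia.
have hl k t : (l k).[t] = a 0 k + t * w 0 k.
  by rewrite !hornerE mulrC.
exists (c *: (l 0 ^+ i * l 1 ^+ j)); split => [|t|t].
- rewrite (leq_trans (size_scale_leq _ _))// (leq_trans (size_polyMleq _ _))//.
  by have := sl 0 i; have := sl 1 j; lia.
- by rewrite /mono !mxE hornerZ hornerM !horner_exp !hl mulrA.
- have dl k : (l k)^`() = (w 0 k)%:P.
    by rewrite derivD derivC derivZ derivX add0r alg_polyC.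
  rewrite derive_mono /mono !mxE derivZ derivM !deriv_exp !dl.
  rewrite hornerZ hornerD !hornerM !hornerMn !hornerM !horner_exp !hl !hornerC.
  move: (a 0 0 + t * w 0 0) (a 0 1 + t * w 0 1) (w 0 0) (w 0 1) => X Y w0 w1.
  rewrite -[c *+ i]mulr_natl -[c *+ j]mulr_natl.
  rewrite -[in RHS](mulr_natl _ i) -[in RHS](mulr_natl _ j).
  by move: (X ^+ i) (X ^+ i.-1) (Y ^+ j) (Y ^+ j.-1) i%:R j%:R => *; ring.
Qed.

End BivariatePolynomials.

(** * Univariate Bernstein polynomials *)

Section Bernstein.
Context {R : realType}.
Implicit Types (n k : nat) (q : {poly R}).

Definition bernp n k : {poly R} := 'C(n, k)%:R *: ('X^k * (1 - 'X) ^+ (n - k)).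

Lemma bern1E n (j : 'I_n.+1) (t : R) : bern1 j t = (bernp n j).[t].
Proof.
by rewrite /bern1 hornerZ hornerM hornerXn horner_exp hornerD hornerN hornerX hornerC mulrA.
Qed.

Definition bcomb n (c : 'cV[R]_n.+1) : {poly R} := \sum_i c i 0 *: bernp n i.

Lemma bern1_comb n (c : 'cV[R]_n.+1) t :
  \sum_i c i 0 *: bern1 i t = (bcomb c).[t].
Proof.
by rewrite horner_sum; apply: eq_bigr => i _; rewrite hornerZ bern1E.
Qed.

Lemma bcombD n (c e : 'cV[R]_n.+1) : bcomb (c + e) = bcomb c + bcomb e.
Proof.
by rewrite /bcomb -big_split; apply: eq_bigr => i _; rewrite mxE scalerDl.
Qed.

Lemma bcombZ n a (c : 'cV[R]_n.+1) : bcomb (a *: c) = a *: bcomb c.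
Proof.
by rewrite /bcomb scaler_sumr; apply: eq_bigr => i _; rewrite mxE scalerA.
Qed.

Lemma bcomb0 n : bcomb (0 : 'cV[R]_n.+1) = 0.
Proof. by rewrite -[X in bcomb X](scale0r 0) bcombZ scale0r. Qed.

Lemma bcombB n (c e : 'cV[R]_n.+1) : bcomb (c - e) = bcomb c - bcomb e.
Proof. by rewrite bcombD -scaleN1r bcombZ scaleN1r. Qed.

Lemma bcomb_sum n I (s : seq I) (F : I -> {poly R}) :
  (forall i, exists c : 'cV[R]_n.+1, F i = bcomb c) ->
  exists c : 'cV[R]_n.+1, \sum_(i <- s) F i = bcomb c.
Proof.
move=> FP; elim: s => [|i s [c IHs]]; first by exists 0; rewrite big_nil bcomb0.
have [e Fi] := FP i.
by exists (e + c); rewrite big_cons Fi IHs bcombD.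
Qed.

(* [X^k = X^k (X + (1 - X))^(n - k)] *)
Lemma polyXn_bcomb n k : (k <= n)%N -> exists c : 'cV[R]_n.+1, 'X^k = bcomb c.
Proof.
move=> kn.
rewrite (_ : 'X^k = \sum_(i < (n - k).+1) 'C(n - k, i)%:R *:
    ('X^(n - i) * (1 - 'X) ^+ i)); last first.
  have E : 1 = ('X + (1 - 'X)) ^+ (n - k) :> {poly R}.
    by rewrite addrC subrK expr1n.
  rewrite -[LHS]mulr1 [X in _ * X = _]E exprDn mulr_sumr; apply: eq_bigr => i _.
  rewrite scaler_nat mulrnAr mulrA -exprD.
  by congr (_ ^+ _ * _ *+ _); have := ltn_ord i; lia.
apply: bcomb_sum => i.
have ni : (n - i < n.+1)%N by rewrite ltnS leq_subr.
exists (('C(n - k, i)%:R / 'C(n, i)%:R) *: delta_mx (Ordinal ni) 0).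
have lin : (i <= n)%N by have := ltn_ord i; lia.
rewrite bcombZ /bcomb (bigD1 (Ordinal ni))//= [X in _ *: (_ + X)]big1 ?addr0.
  rewrite mxE !eqxx scale1r /bernp bin_sub// subKn// scalerA divfK//.
  by rewrite pnatr_eq0 -lt0n bin_gt0.
by move=> j ji; rewrite mxE (negbTE ji) scale0r.
Qed.

Lemma poly_bcomb n q : (size q <= n.+1)%N -> exists c : 'cV[R]_n.+1, q = bcomb c.
Proof.
move=> sq; rewrite -(coefK q) poly_def; apply: bcomb_sum => i.
have [c ->] : exists c : 'cV[R]_n.+1, 'X^i = bcomb c.
  by apply: polyXn_bcomb; have := ltn_ord i; lia.
by exists (q`_i *: c); rewrite bcombZ.
Qed.

(* The coordinates of the monomials give a right inverse, hence a two-sided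
   one, of the matrix of the Bernstein basis in the monomial basis. *)
Lemma bcomb_inj n : injective (@bcomb n).
Proof.
move=> c e ce; apply/eqP; rewrite -subr_eq0; apply/eqP.
have {ce} : bcomb (c - e) = 0 by rewrite bcombB ce subrr.
move: (c - e) => {e}c c0.
have /fin_all_exists[F FE] (k : 'I_n.+1) : exists c : 'cV[R]_n.+1, 'X^k = bcomb c.
  by apply: polyXn_bcomb; rewrite -ltnS.
pose M : 'M[R]_n.+1 := \matrix_(j, k) F k j 0.
pose N : 'M[R]_n.+1 := \matrix_(l, j) (bernp n j)`_l.
have NM : N *m M = 1%:M.
  apply/matrixP => l k; rewrite !mxE.
  have := congr1 (fun q : {poly R} => q`_l) (FE k).
  rewrite coefXn coef_sum => ->; apply: eq_bigr => j _.
  by rewrite coefZ !mxE mulrC.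
have Nc : N *m c = 0.
  apply/matrixP => l k; rewrite !mxE (ord1 k).
  have := congr1 (fun q : {poly R} => q`_l) c0.
  rewrite coef0 coef_sum => {2}<-; apply: eq_bigr => j _.
  by rewrite coefZ !mxE mulrC.
by rewrite -[c]mul1mx -(mulmx1C NM) -mulmxA Nc mulmx0.
Qed.

Lemma horner_inj q1 q2 : (forall t, q1.[t] = q2.[t]) -> q1 = q2.
Proof.
move=> q12; apply/eqP; rewrite -subr_eq0; apply/eqP.
pose s : seq R := [seq i%:R | i <- iota 0 (size (q1 - q2))].
apply: (@roots_geq_poly_eq0 _ _ s).
- by apply/allP => t _; rewrite /root hornerD hornerN q12 subrr.
- by rewrite map_inj_uniq ?iota_uniq//; exact: (mulrIn (oner_neq0 _)).
- by rewrite size_map size_iota.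
Qed.

Lemma deriv_bernp0 n : (bernp n.+1 0)^`() = - (n.+1%:R *: bernp n 0).
Proof.
rewrite /bernp !bin0 !scale1r !expr0 !mul1r deriv_exp derivB derivX derivC sub0r.
by rewrite subn0 /= mulN1r mulNrn scaler_nat subn0.
Qed.

Lemma deriv_bernpS n k : (k <= n)%N ->
  (bernp n.+1 k.+1)^`() = n.+1%:R *: (bernp n k - bernp n k.+1).
Proof.
move=> kn; rewrite /bernp derivZ derivM derivXn deriv_exp derivB derivX derivC.
rewrite sub0r /= subSS scalerDr scalerBr !scalerA; congr (_ + _).
  by rewrite mulrnAl -[(_ * _) *+ _]scaler_nat scalerA -!natrM mulnC -mul_bin_diag.
rewrite mulN1r mulNrn mulrN scalerN; congr (- _).
rewrite mulrnAr -[(_ * _) *+ _]scaler_nat scalerA -!natrM -subnS.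
congr (_%:R *: _).
case: (ltnP k n) => [kn'|nk]; last first.
  by rewrite (@bin_small n k.+1) ?ltnS// muln0 (_ : n - k = 0)%N ?muln0//; lia.
have bl := mul_bin_left n.+1 k.+1; rewrite subSS in bl; rewrite mulnC -bl.
exact/esym/(mul_bin_diag n.+1 k.+1).
Qed.

Lemma deriv_bcomb n (c : 'cV[R]_n.+2) :
  (bcomb c)^`() = bcomb (U_mx n.+1 *m c).
Proof.
pose f k : R := c (inord k) 0.
have cE (i : 'I_n.+2) : c i 0 = f i by rewrite /f inord_val.
have UE (i : 'I_n.+1) : (U_mx n.+1 *m c) i 0 = n.+1%:R * (f i.+1 - f i).
  rewrite mxE.
  under eq_bigr => j _ do rewrite mxE -mulrA mulrBl mulrBr cE.
  rewrite sumrB mulrBr; congr (_ - _).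
    have i1 : (i.+1 < n.+2)%N by rewrite ltnS.
    rewrite (bigD1 (Ordinal i1))//= eqxx mul1r big1 ?addr0// => j.
    by rewrite -val_eqE /= => /negbTE ->; rewrite mul0r mulr0.
  have i1 : (i < n.+2)%N by rewrite ltnW// ltnS.
  rewrite (bigD1 (Ordinal i1))//= eqxx mul1r big1 ?addr0// => j.
  by rewrite -val_eqE /= => /negbTE ->; rewrite mul0r mulr0.
rewrite /bcomb raddf_sum /=.
under eq_bigr => i _ do rewrite derivZ cE.
under [RHS]eq_bigr => i _ do rewrite UE mulrBr scalerBl -!scalerA.
rewrite big_ord_recl deriv_bernp0 sumrB.
under eq_bigr => i _ do
  rewrite lift0 deriv_bernpS -1?ltnS// scalerA mulrC -scalerA scalerBr scalerBr.
rewrite sumrB addrCA; congr (_ + _).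
rewrite scalerN -opprD; congr (- _).
rewrite scalerA mulrC -scalerA -!scaler_sumr -scalerDr; congr (_ *: _).
rewrite -(big_ord_recl _ (fun i => f i *: bernp n i)) big_ord_recr /=.
by rewrite {2}/bernp bin_small// scale0r scaler0 addr0.
Qed.

End Bernstein.

(** * The Bernstein basis of a triangle *)

Section Triangle.
Context {R : realType}.
Local Notation plane := 'rV[R]_2.
Implicit Types (T : 'I_3 -> plane) (m n : nat) (x : plane).

Lemma baryE T i x : let P := T (i + 1) in let Q := T (i + 1 + 1) in
  let a := det2 (P - T i) (Q - T i) in
  bary T i x = det2 P Q / a + (P 0 1 - Q 0 1) / a * x 0 0
               + (Q 0 0 - P 0 0) / a * x 0 1.
Proof.
move=> P Q a; rewrite /bary -/P -/Q -/a /det2 !mxE.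
by move: (a^-1) (x 0 0) (x 0 1) (P 0 0) (P 0 1) (Q 0 0) (Q 0 1) => *; ring.
Qed.

Lemma is_poly_bary T i : is_poly 1 (bary T i).
Proof.
have -> : bary T i = fun x => bary T i x by [].
under eq_fun do rewrite baryE /=.
exact: is_poly_affine.
Qed.

Lemma bary_area T : Defs.nondegenerate T -> let a := det2 (T 1 - T 0) (T (1 + 1) - T 0) in
  [/\ a != 0,
    forall x, bary T 0 x * a = det2 (T 1 - x) (T (1 + 1) - x),
    forall x, bary T 1 x * a = det2 (T (1 + 1) - x) (T 0 - x) &
    forall x, bary T (1 + 1) x * a = det2 (T 0 - x) (T 1 - x)].
Proof.
move=> nd; split => // x; rewrite /bary.
- by rewrite add0r mulfVK.
- have -> : 1 + 1 + 1 = 0 :> 'I_3 by apply/val_inj.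
  set a' := (X in _ / X * _); set a := (X in _ * X = _).
  suff -> : a' = a by rewrite mulfVK.
  by rewrite /a' /a /det2 !mxE; ring.
- have -> : 1 + 1 + 1 = 0 :> 'I_3 by apply/val_inj.
  rewrite add0r; set a' := (X in _ / X * _); set a := (X in _ * X = _).
  suff -> : a' = a by rewrite mulfVK.
  by rewrite /a' /a /det2 !mxE; ring.
Qed.

Lemma sum_I3 (V : nmodType) (F : 'I_3 -> V) :
  \sum_i F i = F 0 + F 1 + F (1 + 1).
Proof.
rewrite !big_ord_recl big_ord0 addr0 addrA.
by congr (_ + F _ + F _); apply/val_inj.
Qed.

Lemma sum_bary T x : Defs.nondegenerate T -> \sum_i bary T i x = 1.
Proof.
move=> nd; have [a0 b0 b1 b2] := bary_area nd.
apply: (mulIf a0); rewrite sum_I3 !mulrDl b0 b1 b2 mul1r /det2 !mxE.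
by ring.
Qed.

Lemma sum_bary_vertex T x : Defs.nondegenerate T -> \sum_i bary T i x *: T i = x.
Proof.
move=> nd; have [a0 b0 b1 b2] := bary_area nd.
apply/rowP => k; apply: (mulIf a0).
rewrite sum_I3 !mxE !mulrDl ![_ * T _ 0 k * _]mulrAC b0 b1 b2 /det2 !mxE.
by have [->|->] := ord2P k;
  move: (T 0 0 0) (T 0 0 1) (T 1 0 0) (T 1 0 1) (T (1 + 1) 0 0) (T (1 + 1) 0 1);
  move: (x 0 0) (x 0 1) => *; ring.
Qed.

Lemma is_poly_bern2 T m (k : 'I_#|midx m|) : is_poly m (bern2 T k).
Proof.
apply: is_polyZ.
have : enum_val k \in midx m by exact: enum_valP.
rewrite inE; move: (enum_val k) => al /eqP alm.
have E s : is_poly (\sum_(i <- s) al i)%N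
    (fun x => \prod_(i <- s) bary T i x ^+ al i).
  elim: s => [|i s IHs].
    rewrite big_nil (_ : (fun _ => _) = fun=> 1); first exact: is_poly_cst.
    by apply/funext => x; rewrite big_nil.
  rewrite big_cons (_ : (fun _ => _) = fun x =>
    bary T i x ^+ al i * \prod_(i <- s) bary T i x ^+ al i); last first.
    by apply/funext => x; rewrite big_cons.
  apply: is_polyM IHs; exact: (is_polyX _ (is_poly_bary T i)).
by rewrite -[X in is_poly X]alm; exact: E.
Qed.

Definition bern_span T m (f : plane -> R) :=
  exists c : 'cV[R]_#|midx m|, forall x, f x = \sum_k c k 0 *: bern2 T k x.

Lemma bern_spanD T m f g : bern_span T m f -> bern_span T m g ->
  bern_span T m (fun x => f x + g x).
Proof.
move=> [c fE] [e gE]; exists (c + e) => x.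
by rewrite fE gE -big_split; apply: eq_bigr => k _; rewrite mxE scalerDl.
Qed.

Lemma bern_spanZ T m a f : bern_span T m f -> bern_span T m (fun x => a * f x).
Proof.
move=> [c fE]; exists (a *: c) => x.
rewrite fE mulr_sumr; apply: eq_bigr => k _; rewrite mxE; exact: mulrA.
Qed.

Lemma bern_span0 T m : bern_span T m (fun=> 0).
Proof. by exists 0 => x; rewrite big1// => k _; rewrite mxE scale0r. Qed.

Lemma bern_span_prod T m (g : 'I_3 -> nat) : (\sum_i g i = m)%N ->
  bern_span T m (fun x => \prod_i bary T i x ^+ g i).
Proof.
move=> gm; pose al : {ffun 'I_3 -> 'I_m.+1} := [ffun i => inord (g i)].
have alE i : al i = g i :> nat.
  by rewrite ffunE inordK// -gm (bigD1 i)//= ltnS leq_addr.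
have alm : al \in midx m.
  by rewrite inE; apply/eqP; rewrite -[RHS]gm; apply: eq_bigr.
pose k := enum_rank_in alm al.
have kE : enum_val k = al by rewrite enum_rankK_in.
pose a : R := m`!%:R / (\prod_i (al i)`!)%:R.
have a0 : a != 0.
  rewrite mulf_neq0 ?invr_eq0// pnatr_eq0 -lt0n ?fact_gt0//.
  by apply: prodn_gt0 => i; rewrite fact_gt0.
exists (a^-1 *: delta_mx k 0) => x.
rewrite (bigD1 k)//= [X in _ + X]big1 ?addr0 => [|l lk]; last first.
  by rewrite !mxE (negbTE lk) mulr0 scale0r.
rewrite !mxE !eqxx mulr1 /bern2 kE -/a /GRing.scale /= mulrA mulVf// mul1r.
by apply: eq_bigr => i _; rewrite alE.
Qed.

Lemma bern_span_bary T m i f : bern_span T m f ->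
  bern_span T m.+1 (fun x => bary T i x * f x).
Proof.
move=> [c fE]; pose P k (x : plane) := bary T i x * (c k 0 * bern2 T k x).
rewrite (_ : (fun _ => _) = fun x => \sum_k P k x); last first.
  by apply/funext => x; rewrite fE mulr_sumr.
apply: sum_closed => [|u v|k _]; [exact: bern_span0|exact: bern_spanD|].
have : enum_val k \in midx m by exact: enum_valP.
rewrite inE => /eqP km; pose g j : nat := (enum_val k j + (j == i))%N.
have gm : (\sum_j g j = m.+1)%N.
  rewrite /g big_split/= km (bigD1 i)//= eqxx big1 ?addn1// => j.
  by move=> /negbTE ->.
pose a : R := m`!%:R / (\prod_j (enum_val k j)`!)%:R.
rewrite (_ : P k = fun x => (c k 0 * a) * \prod_j bary T j x ^+ g j).
  exact/bern_spanZ/bern_span_prod.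
apply/funext => x; rewrite /P /bern2 -/a /g.
under [in RHS]eq_bigr do rewrite exprD.
rewrite big_split/= [X in _ = _ * (_ * X)](bigD1 i)//= eqxx expr1.
rewrite [X in _ = _ * (_ * (_ * X))]big1 ?mulr1; last first.
  by move=> j /negbTE ->; rewrite expr0.
move: (bary T i x) (\prod_j _) => X Y.
by rewrite [X * _]mulrC !mulrA.
Qed.

Lemma bern_span_affine T m (l : 'I_3 -> R) f : bern_span T m f ->
  bern_span T m.+1 (fun x => (\sum_i l i * bary T i x) * f x).
Proof.
move=> fS; rewrite (_ : (fun _ => _) = fun x =>
  \sum_i (fun i x => l i * (bary T i x * f x)) i x); last first.
  by apply/funext => x; rewrite mulr_suml; apply: eq_bigr => i _; rewrite mulrA.
apply: sum_closed => [|u v|k _]; [exact: bern_span0|exact: bern_spanD|].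
exact/bern_spanZ/bern_span_bary.
Qed.

Lemma is_poly_bern_span T m p : Defs.nondegenerate T ->
  is_poly m p -> bern_span T m p.
Proof.
move=> nd; move: p; apply: is_poly_ind => [c i j ij|]; last exact: bern_spanD.
have one n f : bern_span T n f -> bern_span T n.+1 f.
  move=> /(bern_span_affine (fun=> 1)); congr bern_span; apply/funext => x.
  by under eq_bigr do rewrite mul1r; rewrite sum_bary// mul1r.
have coord (k : 'I_2) n f : bern_span T n f ->
    bern_span T n.+1 (fun x => x 0 k * f x).
  move=> /(bern_span_affine (fun i => T i 0 k)); congr bern_span.
  apply/funext => x; congr (_ * _).
  rewrite -[in RHS](sum_bary_vertex x nd) summxE; apply: eq_bigr => l _.
  by rewrite mxE mulrC.
have Y : bern_span T j (fun x => x 0 1 ^+ j).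
  elim: j {ij} => [|j /(coord 1)].
    have := @bern_span_prod T 0 (fun=> 0%N); rewrite big1// => /(_ erefl).
    by congr bern_span; apply/funext => x; rewrite big1.
  by congr bern_span; apply/funext => x; rewrite exprS.
have XY : bern_span T (i + j) (fun x => x 0 0 ^+ i * x 0 1 ^+ j).
  elim: i {ij} => [|i /(coord 0)].
    by move: Y; congr bern_span; apply/funext => x; rewrite mul1r.
  by congr bern_span; apply/funext => x; rewrite exprS mulrA.
rewrite (_ : mono c i j = fun x => c * (x 0 0 ^+ i * x 0 1 ^+ j)); last first.
  by apply/funext => x; rewrite mulrA.
apply: bern_spanZ; rewrite -(subnK ij).
by elim: (m - (i + j))%N => // n; exact: one.
Qed.

End Triangle.

(** * Gradient and curl in the frame of an edge *)

Section Frame.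
Context {R : realType}.
Local Notation plane := 'rV[R]_2.
Implicit Types (T : 'I_3 -> plane) (m n : nat) (x a b w : plane)
  (p : plane -> R) (v : plane -> plane).

Lemma dotE (u w : plane) : dot u w = u 0 0 * w 0 0 + u 0 1 * w 0 1.
Proof.
rewrite /dot !big_ord_recl big_ord0 addr0.
by congr (_ + u 0 _ * w 0 _); apply/val_inj.
Qed.

Lemma dot_sum I (s : seq I) (P : pred I) (F : I -> plane) w :
  dot (\sum_(i <- s | P i) F i) w = \sum_(i <- s | P i) dot (F i) w.
Proof.
rewrite /dot exchange_big; apply: eq_bigr => k _.
by rewrite summxE mulr_suml.
Qed.

Lemma dotZl c (u w : plane) : dot (c *: u) w = c * dot u w.
Proof. by rewrite !dotE !mxE mulrDr !mulrA. Qed.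

Lemma gradE f x : grad f x = D ex f x *: ex + D ey f x *: ey.
Proof. by rewrite !DE. Qed.

Lemma grad00 f x : grad f x 0 0 = D ex f x.
Proof. by rewrite gradE !mxE mulr1 mulr0 addr0. Qed.

Lemma grad01 f x : grad f x 0 1 = D ey f x.
Proof. by rewrite gradE !mxE mulr1 mulr0 add0r. Qed.

Lemma curlE v x :
  curl v x = D ex (fun y => v y 0 1) x - D ey (fun y => v y 0 0) x.
Proof. by rewrite !DE. Qed.

Lemma dot_grad m p w : is_poly m p -> (fun x => dot (grad p x) w) = D w p.
Proof.
move=> pP; rewrite (poly_deriveE w pP); apply/funext => x.
by rewrite dotE grad00 grad01 mulrC [X in _ + X]mulrC.
Qed.

Lemma is_vpoly_grad m p : is_poly m p -> is_vpoly m.-1 (grad p).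
Proof.
move=> pP k.
have [->|->] := ord2P k.
  rewrite (_ : (fun x => _) = D ex p); first exact: is_poly_derive.
  by apply/funext => x; rewrite grad00.
rewrite (_ : (fun x => _) = D ey p); first exact: is_poly_derive.
by apply/funext => x; rewrite grad01.
Qed.

Lemma is_poly_curl m v : is_vpoly m v -> is_poly m.-1 (curl v).
Proof.
move=> vP; rewrite (_ : curl v = fun x => D ex (fun y => v y 0 1) x +
    (fun x => - D ey (fun y => v y 0 0) x) x); last first.
  by apply/funext => x; rewrite curlE.
by apply: is_polyD; [|apply: is_polyN]; apply: is_poly_derive; exact: vP.
Qed.

Lemma is_poly_dot m v w : is_vpoly m v -> is_poly m (fun x => dot (v x) w).
Proof.
move=> vP; rewrite (_ : (fun x => _) =
    fun x => w 0 0 * v x 0 0 + w 0 1 * v x 0 1); last first.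
  by apply/funext => x; rewrite dotE mulrC [X in _ + X]mulrC.
by apply: is_polyD; apply: is_polyZ; exact: vP.
Qed.

Lemma curl_grad m p x : is_poly m p -> curl (grad p) x = 0.
Proof.
move=> pP; rewrite curlE.
rewrite (_ : (fun y => _) = D ey p); last by apply/funext => y; rewrite grad01.
rewrite (_ : (fun y => _) = D ex p); last by apply/funext => y; rewrite grad00.
by rewrite (poly_derive_exy pP) subrr.
Qed.

Lemma derive_dot m v u w : is_vpoly m v -> D u (fun x => dot (v x) w) =
  fun x => w 0 0 * D u (fun y => v y 0 0) x + w 0 1 * D u (fun y => v y 0 1) x.
Proof.
move=> vP.
rewrite (_ : (fun x => _) = fun x => w 0 0 * v x 0 0 + w 0 1 * v x 0 1); last first.
  by apply/funext => x; rewrite dotE mulrC [X in _ + X]mulrC.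
rewrite (poly_deriveD _ (is_polyZ _ (vP 0)) (is_polyZ _ (vP 1))).
by rewrite (poly_deriveZ _ _ (vP 0)) (poly_deriveZ _ _ (vP 1)).
Qed.

Lemma elen_gt0 a b : a != b -> 0 < elen a b.
Proof.
move=> ab; rewrite sqrtr_gt0 dotE -!expr2 lt_neqAle addr_ge0 ?sqr_ge0// andbT.
rewrite eq_sym paddr_eq0 ?sqr_ge0// !sqrf_eq0; apply: contra ab.
move=> /andP[/eqP d0 /eqP d1]; rewrite eq_sym -subr_eq0; apply/eqP/rowP => k.
by rewrite [RHS]mxE; have [->|->] := ord2P k.
Qed.

Lemma normal00 a b : normal a b 0 0 = - tangent a b 0 1.
Proof. by rewrite !mxE mulr0 mulr1 add0r. Qed.

Lemma normal01 a b : normal a b 0 1 = tangent a b 0 0.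
Proof. by rewrite !mxE mulr0 mulr1 subr0. Qed.

Lemma tangent_unit a b : a != b -> tangent a b 0 0 ^+ 2 + tangent a b 0 1 ^+ 2 = 1.
Proof.
move=> ab; have e0 := elen_gt0 ab.
rewrite /tangent [in LHS]mxE [X in _ + X ^+ 2]mxE !exprMn -mulrDr.
have -> : (b - a) 0 0 ^+ 2 + (b - a) 0 1 ^+ 2 = elen a b ^+ 2.
  by rewrite sqr_sqrtr dotE -!expr2 // addr_ge0 ?sqr_ge0.
by rewrite exprVn mulVf// sqrf_eq0 gt_eqF.
Qed.

(* The curl is invariant under rotation of the frame. *)
Lemma curl_frame m v a b : a != b -> is_vpoly m v ->
  curl v = fun x => D (tangent a b) (fun y => dot (v y) (normal a b)) x
                    + - D (normal a b) (fun y => dot (v y) (tangent a b)) x.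
Proof.
move=> ab vP; apply/funext => x; rewrite curlE !(derive_dot _ _ vP).
rewrite !(poly_deriveE (normal a b) (vP _)) !(poly_deriveE (tangent a b) (vP _)).
rewrite normal00 normal01; have := tangent_unit ab.
move: (tangent a b 0 0) (tangent a b 0 1) => t0 t1 t01.
move: (D ex _ x) (D ex _ x) (D ey _ x) (D ey _ x) => A B C E.
rewrite -[LHS]mul1r -t01.
by ring.
Qed.

End Frame.

(** * Matrices of the trace operators *)

Section Traces.
Context {R : realType}.
Local Notation plane := 'rV[R]_2.
Implicit Types (T : 'I_3 -> plane) (m n : nat) (x a b w : plane)
  (p : plane -> R) (v : plane -> plane).

Lemma op_mxE (X Y : Type) (V W : lmodType R) n n'
    (B : 'I_n -> X -> V) (B' : 'I_n' -> Y -> W) L j :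
  (exists c : 'cV[R]_n', forall y, L (B j) y = \sum_i c i 0 *: B' i y) ->
  forall y, L (B j) y = \sum_i col j (op_mx B B' L) i 0 *: B' i y.
Proof.
move=> exc y; under eq_bigr do rewrite !mxE.
exact: (@xgetPex _ 0 [set c : 'cV[R]_n' | forall y, L (B j) y = \sum_i c i 0 *: B' i y]).
Qed.

Lemma op_mx_comb (X : Type) (V : lmodType R) n n'
    (B : 'I_n -> X -> V) L (c : 'cV[R]_n) t :
  (forall j, exists e : 'cV[R]_n'.+1,
     forall t, L (B j) t = \sum_i e i 0 *: bern1 i t) ->
  (bcomb (op_mx B (@bern1 R n') L *m c)).[t] = \sum_j c j 0 * L (B j) t.
Proof.
move=> exe; rewrite -bern1_comb.
under eq_bigr => i _ do rewrite mxE scaler_suml.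
rewrite exchange_big; apply: eq_bigr => j _ /=.
rewrite (op_mxE (exe j)) mulr_sumr; apply: eq_bigr => i _.
rewrite [col _ _ _ _]mxE; move: (op_mx _ _ _ _ _) (bern1 i t) => A e.
by rewrite [A * _]mulrC /GRing.scale /= mulrA.
Qed.

Lemma normal_derE a b m p t :
  normal_der a b m p t = Diter (normal a b) m p (a + t *: (b - a)).
Proof.
rewrite /normal_der /Diter; congr (_ _).
by elim: m => //= m ->; rewrite DE.
Qed.

Lemma normal_der_bern1 a b m m0 p : is_poly m0 p ->
  exists e : 'cV[R]_(m0 - m).+1,
    forall t, normal_der a b m p t = \sum_i e i 0 *: bern1 i t.
Proof.
move=> pP; have pP' := is_poly_Diter (normal a b) m pP.
have [q [sq qE _]] := is_poly_line a (b - a) pP'.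
have [c cE] := poly_bcomb sq.
by exists c => t; rewrite normal_derE qE cE -bern1_comb.
Qed.

Lemma Diter_sum m n I (s : seq I) (c : I -> R) (F : I -> plane -> R) (u : plane) :
  (forall i, is_poly m (F i)) ->
  Diter u n (fun x => \sum_(i <- s) c i * F i x) =
  fun x => \sum_(i <- s) c i * Diter u n (F i) x.
Proof.
move=> FP; elim: s => [|i s IHs].
  have H0 : is_poly 0 ((fun=> 0) : plane -> R) by exact: is_poly_cst.
  have := DiterZ 0 u n H0.
  rewrite (_ : (fun x => 0 * _) = fun=> 0); last by apply/funext => x; rewrite mul0r.
  rewrite [X in X = _](_ : _ = Diter u n (fun x => \sum_(i <- [::]) c i * F i x)).
    by move=> ->; apply/funext => x; rewrite big_nil mul0r.
  by congr Diter; apply/funext => x; rewrite big_nil.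
rewrite (_ : (fun x => _) = fun x => c i * F i x + \sum_(i <- s) c i * F i x).
  rewrite (DiterD _ _ (is_polyZ (c i) (FP i)) (is_poly_sum _ _)).
    rewrite (DiterZ _ _ _ (FP i)) IHs.
    by apply/funext => x; rewrite big_cons.
  by move=> j _; exact: is_polyZ.
by apply/funext => x; rewrite big_cons.
Qed.

Lemma gamma_s_comb T a b m0 m (c : 'cV[R]_#|midx m0|) t :
  (bcomb (gamma_s T a b m0 m *m c)).[t] =
  normal_der a b m (fun x => \sum_k c k 0 * bern2 T k x) t.
Proof.
rewrite op_mx_comb => [|j]; last exact/normal_der_bern1/is_poly_bern2.
rewrite normal_derE (@Diter_sum m0 m _ _ _ (bern2 T (m:=m0)) _ (@is_poly_bern2 _ T m0)).
by apply: eq_bigr => j _; rewrite normal_derE.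
Qed.

Lemma is_vpoly_vbern2 T m (k : 'I_(#|midx m| + #|midx m|)) : is_vpoly m (vbern2 T k).
Proof.
rewrite /vbern2; case: fintype.split => l i.
  rewrite (_ : (fun x => _) = fun x => (ex : plane) 0 i * bern2 T l x).
    exact/is_polyZ/is_poly_bern2.
  by apply/funext => x; rewrite mxE mulrC.
rewrite (_ : (fun x => _) = fun x => (ey : plane) 0 i * bern2 T l x).
  exact/is_polyZ/is_poly_bern2.
by apply/funext => x; rewrite mxE mulrC.
Qed.

Lemma gamma_v_comb w T a b m0 m (c : 'cV[R]_(#|midx m0| + #|midx m0|)) t :
  (bcomb (gamma_v w T a b m0 m *m c)).[t] =
  normal_der a b m (fun x => dot (\sum_k c k 0 *: vbern2 T k x) w) t.
Proof.
rewrite op_mx_comb => [|j]; last first.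
  exact/normal_der_bern1/is_poly_dot/is_vpoly_vbern2.
rewrite (_ : (fun x => dot _ _) =
    fun x => \sum_k c k 0 * dot (vbern2 T k x) w); last first.
  by apply/funext => x; rewrite dot_sum; apply: eq_bigr => k _; rewrite dotZl.
rewrite normal_derE (@Diter_sum _ _ _ _ _ (fun k x => dot (vbern2 T k x) w)
  _ (fun k => is_poly_dot _ (is_vpoly_vbern2 T k))).
by apply: eq_bigr => j _; rewrite normal_derE.
Qed.

Lemma vpoly_vbern2 T m v : Defs.nondegenerate T -> is_vpoly m v ->
  exists c : 'cV[R]_(#|midx m| + #|midx m|),
    forall x, v x = \sum_k c k 0 *: vbern2 T k x.
Proof.
move=> nd vP.
have [c cE] := is_poly_bern_span nd (vP 0).
have [e eE] := is_poly_bern_span nd (vP 1).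
exists (col_mx c e) => x; rewrite big_split_ord /=.
under eq_bigr do rewrite col_mxEu /vbern2 (unsplitK (inl _)) scalerA.
under [X in _ + X]eq_bigr do rewrite col_mxEd /vbern2 (unsplitK (inr _)) scalerA.
rewrite -!scaler_suml; apply/rowP => k; rewrite !mxE.
have [->|->] := ord2P k; rewrite ?(mulr1, mulr0, addr0, add0r).
  exact: cE.
exact: eE.
Qed.

Lemma G_mx_col T d j x : Defs.nondegenerate T ->
  grad (bern2 T (m := d) j) x = \sum_k col j (G_mx T d) k 0 *: vbern2 T k x.
Proof.
move=> nd; apply: (@op_mxE _ _ _ _ _ _ (bern2 T (m := d))).
exact/(vpoly_vbern2 nd)/is_vpoly_grad/is_poly_bern2.
Qed.

Lemma curl_mx_col T d j x : Defs.nondegenerate T ->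
  curl (vbern2 T (m := d) j) x = \sum_k col j (curl_mx T d) k 0 *: bern2 T k x.
Proof.
move=> nd; apply: (@op_mxE _ _ _ _ _ _ (vbern2 T (m := d))).
exact/(is_poly_bern_span nd)/is_poly_curl/is_vpoly_vbern2.
Qed.

Lemma bcomb_conform_U n n' (c : 'cV[R]_n.+1) : n = n'.+1 ->
  bcomb (conform_mx (0 : 'M[R]_(n'.+1, n.+1)) (U_mx n) *m c) = (bcomb c)^`().
Proof. by move=> nn'; subst n; rewrite conform_mx_id deriv_bcomb. Qed.

Lemma bcomb_conform_1 n n' (c : 'cV[R]_n.+1) : n = n' ->
  bcomb (conform_mx (0 : 'M[R]_(n'.+1, n.+1)) (1%:M : 'M[R]_n.+1) *m c) = bcomb c.
Proof. by move=> nn'; subst n'; rewrite conform_mx_id mul1mx. Qed.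

Lemma bcomb_mx_inj n k (A B : 'M[R]_(n.+1, k)) :
  (forall j t, (bcomb (A *m delta_mx j 0)).[t] = (bcomb (B *m delta_mx j 0)).[t]) ->
  A = B.
Proof.
move=> AB; apply/matrixP => i j.
have := bcomb_inj (horner_inj (AB j)); rewrite -!colE.
by move=> /matrixP/(_ i 0); rewrite !mxE.
Qed.

End Traces.

(** * Edge-local factors *)

Section Blocks.
Context {R : realType}.
Local Notation plane := 'rV[R]_2.
Implicit Types (T : 'I_3 -> plane) (m n d : nat) (x a b w : plane)
  (p : plane -> R) (v : plane -> plane).

Lemma derive_line n p a w (q : {poly R}) t : is_poly n p ->
  (forall t, q.[t] = p (a + t *: w)) -> q^`().[t] = D w p (a + t *: w).
Proof.
move=> pP qE; have [q' [_ q'E ->]] := is_poly_line a w pP.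
by congr (_^`().[_]); apply: horner_inj => s; rewrite qE q'E.
Qed.

Lemma derive_tangent n p a b x : is_poly n p ->
  D (tangent a b) p x = (elen a b)^-1 * D (b - a) p x.
Proof. by move=> pP; rewrite (poly_deriveZv _ _ pP). Qed.

Lemma gamma_v_grad T a b w d m j t : Defs.nondegenerate T ->
  (bcomb (gamma_v w T a b d.-1 m *m G_mx T d *m delta_mx j 0)).[t] =
  Diter (normal a b) m (D w (bern2 T j)) (a + t *: (b - a)).
Proof.
move=> nd; rewrite -mulmxA -colE gamma_v_comb normal_derE; congr (Diter _ _ _ _).
rewrite -(dot_grad w (is_poly_bern2 T j)); apply/funext => x.
by rewrite -(G_mx_col _ _ nd).
Qed.

Lemma gamma_s_col T a b d m j t :
  (bcomb (gamma_s T a b d m *m delta_mx j 0)).[t] =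
  Diter (normal a b) m (bern2 T j) (a + t *: (b - a)).
Proof.
rewrite gamma_s_comb normal_derE; congr (Diter _ _ _ _); apply/funext => x.
rewrite (bigD1 j)//= [X in _ + X]big1 ?addr0 => [|k kj].
  by rewrite mxE !eqxx mul1r.
by rewrite mxE (negbTE kj) mul0r.
Qed.

Lemma gamma_v_col w T a b d m j t :
  (bcomb (gamma_v w T a b d m *m delta_mx j 0)).[t] =
  Diter (normal a b) m (fun x => dot (vbern2 T j x) w) (a + t *: (b - a)).
Proof.
rewrite gamma_v_comb normal_derE; congr (Diter _ _ _ _); apply/funext => x.
congr (dot _ _); rewrite (bigD1 j)//= [X in _ + X]big1 ?addr0 => [|k kj].
  by rewrite mxE !eqxx scale1r.
by rewrite mxE (negbTE kj) scale0r.
Qed.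

Lemma gamma_grad_tangent T a b d m : Defs.nondegenerate T -> (m < d)%N ->
  gamma_v (tangent a b) T a b d.-1 m *m G_mx T d =
  ((elen a b)^-1 *: conform_mx 0 (U_mx (d - m))) *m gamma_s T a b d m.
Proof.
move=> nd md; apply: bcomb_mx_inj => j t; rewrite gamma_v_grad//.
rewrite -mulmxA -scalemxAl bcombZ hornerZ bcomb_conform_U; last by lia.
have bP := is_poly_bern2 T j; have bP' := is_poly_Diter (normal a b) m bP.
rewrite (derive_line _ bP' (gamma_s_col T a b m j)).
by rewrite (Diter_derive _ _ _ bP) (derive_tangent _ _ _ bP').
Qed.

Lemma gamma_grad_normal T a b d m : Defs.nondegenerate T ->
  gamma_v (normal a b) T a b d.-1 m *m G_mx T d =
  conform_mx 0 (1%:M : 'M[R]_((d - m.+1).+1)) *m gamma_s T a b d m.+1.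
Proof.
move=> nd; apply: bcomb_mx_inj => j t; rewrite gamma_v_grad//.
rewrite -mulmxA bcomb_conform_1; last by lia.
by rewrite gamma_s_col /Diter iterSr.
Qed.

Lemma gamma_curl T a b d m k l : Defs.nondegenerate T -> a != b ->
  (m.+1 < d)%N -> k = m -> l = m.+1 ->
  gamma_s T a b d.-2 m *m curl_mx T d.-1 =
  ((elen a b)^-1 *: conform_mx 0 (U_mx (d.-1 - m)))
    *m gamma_v (normal a b) T a b d.-1 k +
  - conform_mx 0 (1%:M : 'M[R]_((d.-1 - l).+1))
    *m gamma_v (tangent a b) T a b d.-1 l.
Proof.
move=> nd ab md -> ->; apply: bcomb_mx_inj => j t.
rewrite -mulmxA -colE gamma_s_comb normal_derE.
rewrite (_ : (fun x => _) = curl (vbern2 T j)); last first.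
  by apply/funext => x; rewrite (curl_mx_col _ _ nd).
have bP := is_vpoly_vbern2 T j.
rewrite (curl_frame ab bP).
have tP := is_poly_dot (tangent a b) bP; have nP := is_poly_dot (normal a b) bP.
rewrite (DiterD _ _ (is_poly_derive _ nP) (is_polyN (is_poly_derive _ tP))).
rewrite mulmxDl bcombD hornerD; congr (_ + _).
  rewrite -mulmxA -scalemxAl bcombZ hornerZ bcomb_conform_U; last by lia.
  have nP' := is_poly_Diter (normal a b) m nP.
  rewrite (derive_line _ nP' (gamma_v_col _ T a b m j)).
  by rewrite (Diter_derive _ _ _ nP) (derive_tangent _ _ _ nP').
rewrite -mulmxA mulNmx -[X in bcomb X]scaleN1r bcombZ hornerZ bcomb_conform_1; last by lia.
rewrite gamma_v_col /Diter iterSr -/(Diter _ _ _).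
rewrite -[RHS](congr1 (fun f => f _) (DiterZ (-1) _ _ (is_poly_derive _ tP))).
by congr (Diter _ _ _ _); apply/funext => x; rewrite mulN1r.
Qed.

Lemma Gamma_grad T a b r d : Defs.nondegenerate T -> (r < d)%N ->
  Gamma_v T a b d.-1 r *m G_mx T d = B_mx a b r d *m Gamma_s T a b d r.+1.
Proof.
move=> nd rd; rewrite /Gamma_v /Gamma_s /B_mx mxblockEv !mxcol_mul.
apply/eq_mxcol => i; rewrite mul_mxrow_mxcol.
have ir : (i./2 < r)%N by have := ltn_ord i; lia.
have [oi|ei] := boolP (odd i).
  have i1 : (i./2.+1 < r.+1)%N by [].
  rewrite (bigD1 (Ordinal i1))//= eqxx [X in _ + X]big1 ?addr0.
    exact: gamma_grad_normal.
  by move=> j; rewrite -val_eqE /= => /negbTE ->; rewrite mul0mx.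
have i1 : (i./2 < r.+1)%N by lia.
rewrite (bigD1 (Ordinal i1))//= eqxx [X in _ + X]big1 ?addr0.
  by apply: gamma_grad_tangent => //; lia.
by move=> j; rewrite -val_eqE /= => /negbTE ->; rewrite mul0mx.
Qed.

Lemma Gamma_curl T a b r d : Defs.nondegenerate T -> a != b -> (r < d)%N ->
  Gamma_s T a b d.-2 r.-1 *m curl_mx T d.-1 =
  Bcurl_mx a b r d *m Gamma_v T a b d.-1 r.
Proof.
move=> nd ab rd; rewrite /Gamma_v /Gamma_s /Bcurl_mx mxblockEv !mxcol_mul.
apply/eq_mxcol => i; rewrite mul_mxrow_mxcol.
have ir := ltn_ord i.
have i1 : (i.*2.+1 < r.*2)%N by lia.
have i2 : (i.*2.+2 < r.*2)%N by lia.
rewrite (bigD1 (Ordinal i1))//= eqxx (bigD1 (Ordinal i2))/=; last first.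
  by rewrite -val_eqE /=; lia.
rewrite [X in _ + (_ + X)]big1 ?addr0; last first.
  by move=> j; rewrite -!val_eqE /= => /andP[/negbTE -> /negbTE ->]; rewrite mul0mx.
rewrite !eqxx odd_double /= (_ : (i.*2.+2 == i.*2.+1) = false); last by lia.
apply: gamma_curl => //; lia.
Qed.

Lemma jump_mx_blockdiag N nE (p q p' q' : nat) (Tp Tm : 'I_nE -> 'I_N)
    (G : 'I_nE -> 'I_N -> 'M[R]_(p, q)) (A : 'I_N -> 'M[R]_(q, q'))
    (B : 'I_nE -> 'M[R]_(p, p')) (G' : 'I_nE -> 'I_N -> 'M[R]_(p', q')) :
  (forall e i, i = Tp e \/ i = Tm e -> G e i *m A i = B e *m G' e i) ->
  jump_mx Tp Tm G *m blockdiag A = blockdiag B *m jump_mx Tp Tm G'.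
Proof.
move=> GA; rewrite /jump_mx /blockdiag.
rewrite [X in X *m _ = _]mxblockEv [X in _ *m X = _]mxblockEh mul_mxcol_mxrow.
rewrite [X in _ = X *m _]mxblockEv [X in _ = _ *m X]mxblockEh mul_mxcol_mxrow.
apply/eq_mxblock => e i; rewrite !mul_mxrow_mxcol.
rewrite (bigD1 i)//= eqxx [X in _ + X]big1 ?addr0; last first.
  by move=> j /negbTE ->; rewrite mulmx0.
rewrite [RHS](bigD1 e)//= eqxx [X in _ = _ + X]big1 ?addr0; last first.
  by move=> f; rewrite eq_sym => /negbTE ->; rewrite mul0mx.
case: eqP => [iT|_]; first by apply: GA; left.
case: eqP => [iT|_]; last by rewrite mul0mx mulmx0.
by rewrite mulNmx mulmxN; congr (- _); apply: GA; right.
Qed.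

Lemma edge_neq T a b : Defs.nondegenerate T -> edge T a b -> a != b.
Proof.
move=> nd [k [l [kl -> ->]]]; apply/negP => /eqP Tkl.
suff : det2 (T 1 - T 0) (T (1 + 1) - T 0) = 0 by exact/eqP.
rewrite /det2 !mxE; move: kl Tkl.
have [->|->|->] := ord3P k; have [->|->|->] := ord3P l;
  rewrite ?eqxx// => _ ->; rewrite ?subrr ?mul0r ?mulr0 ?subrr//.
all: by rewrite mulrC subrr.
Qed.

End Blocks.

(** * Smooth piecewise polynomials *)

Section Smooth.
Context {R : realType}.
Local Notation plane := 'rV[R]_2.
Implicit Types (U : set plane) (f g : plane -> R) (x y v : plane).

Lemma D_near f g x v : (\forall y \near x, f y = g y) -> D v f x = D v g x.
Proof. by move=> fg; rewrite !DE; exact: near_eq_derive. Qed.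

Lemma CrS n U f : Cr n.+1 U f <->
  [/\ forall x, U x -> {for x, continuous f},
      forall x, U x -> derivable f x ex /\ derivable f x ey,
      Cr n U (D ex f) & Cr n U (D ey f)].
Proof. by rewrite !DE; split=> [[? []]|[]]. Qed.

Lemma Cr_continuous n U f x : Cr n U f -> U x -> {for x, continuous f}.
Proof. by case: n => [|n] [fc _]; exact: fc. Qed.

Lemma open_near_eq U f g x : open U -> U x -> (forall y, U y -> f y = g y) ->
  \forall y \near x, f y = g y.
Proof.
move=> oU Ux fg; have : \forall y \near x, U y by exact: open_nbhs_nbhs.
by apply: filterS => y; exact: fg.
Qed.

Lemma eq_Cr n U f g : open U -> (forall x, U x -> f x = g x) -> Cr n U f -> Cr n U g.
Proof.
move=> oU; elim: n => [|n IHn] in f g *; move=> fg.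
  move=> [fc _]; split => // x Ux.
  rewrite /prop_for /continuous_at -(fg _ Ux).
  exact: cvg_trans (near_eq_cvg (open_near_eq oU Ux fg)) (fc x Ux).
move=> /CrS[fc fd fx fy]; apply/CrS.
have gf x : U x -> \forall y \near x, f y = g y by move=> Ux; exact: open_near_eq fg.
split => [x Ux|x Ux| |].
- rewrite /prop_for /continuous_at -(fg _ Ux).
  exact: cvg_trans (near_eq_cvg (gf _ Ux)) (fc x Ux).
- have [dx dy] := fd x Ux.
  by split; [apply: near_eq_derivable dx|apply: near_eq_derivable dy];
    exact: gf.
- by apply: IHn fx => x Ux; apply: D_near; exact: gf.
- by apply: IHn fy => x Ux; apply: D_near; exact: gf.
Qed.

Lemma CrB n U f g : open U -> Cr n U f -> Cr n U g -> Cr n U (fun x => f x - g x).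
Proof.
move=> oU; elim: n => [|n IHn] in f g *.
  move=> [fc _] [gc _]; split => // x Ux.
  exact: (cvgB (fc x Ux) (gc x Ux)).
move=> /CrS[fc fd fx fy] /CrS[gc gd gx gy]; apply/CrS; split => [x Ux|x Ux| |].
- exact: (cvgB (fc x Ux) (gc x Ux)).
- have [dx dy] := fd x Ux; have [ex' ey'] := gd x Ux.
  by split; exact: derivableB.
- apply: eq_Cr (IHn _ _ fx gx) => // x Ux.
  rewrite !DE; apply/esym/deriveB; first by have [] := fd x Ux.
  by have [] := gd x Ux.
- apply: eq_Cr (IHn _ _ fy gy) => // x Ux.
  rewrite !DE; apply/esym/deriveB; first by have [] := fd x Ux.
  by have [] := gd x Ux.
Qed.

Lemma bary_comb (T : 'I_3 -> plane) (l : 'I_3 -> R) i : Defs.nondegenerate T ->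
  \sum_j l j = 1 -> bary T i (\sum_j l j *: T j) = l i.
Proof.
move=> nd; rewrite !sum_I3 => l1; have [a0 b0 b1 b2] := bary_area nd.
have l0 : l 0 = 1 - l 1 - l (1 + 1) by rewrite -l1; ring.
apply: (mulIf a0).
have [->|->|->] := ord3P i;
  rewrite ?b0 ?b1 ?b2 l0 /det2 !mxE;
  move: (T 0 0 0) (T 0 0 1) (T 1 0 0) (T 1 0 1) (T (1 + 1) 0 0) (T (1 + 1) 0 1);
  by move: (l 1) (l (1 + 1)) => *; ring.
Qed.

Lemma positive_closed_triangle (T : 'I_3 -> plane) (l : 'I_3 -> R) :
  Defs.nondegenerate T -> \sum_j l j = 1 -> (forall j, 0 < l j) ->
  \forall y \near \sum_j l j *: T j, closed_triangle T y.
Proof.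
move=> nd l1 l0; set x := \sum_j _.
have : \forall y \near x, forall i, 0 < bary T i y.
  apply: (@filter_forall _ _ (fun i y => 0 < bary T i y) _ (nbhs_filter x)) => i.
  have /(_ x) := is_poly_continuous (is_poly_bary T i).
  by move=> /cvgr_gt; apply; rewrite bary_comb.
apply: filterS => y y0; exists (bary T ^~ y); split => [i| |].
- exact: ltW.
- exact: sum_bary.
- by rewrite sum_bary_vertex.
Qed.

(* Both derivatives are continuous at [x] and agree at the points of the open
   triangle on the segment from [x] to the barycentre. *)
Lemma agree_D N (tri : 'I_N -> 'I_3 -> plane) m (s : plane -> R)
    (u : 'I_N -> plane -> R) v : triangulation tri ->
  (forall x, domain tri x -> {for x, continuous (D v s)}) ->
  (forall i, is_poly m (u i)) -> agree tri s u ->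
  agree tri (D v s) (fun i => D v (u i)).
Proof.
move=> [nd _ _ _] Dsc uP su i x [l [l0 l1 xE]] Ox.
pose c : plane := \sum_j 3^-1 *: tri i j.
pose y (t : R) : plane := x + t *: (c - x).
have yx : y t @[t --> 0^'+] --> x.
  rewrite -[X in _ --> X]addr0 -(scale0r (c - x)).
  apply: cvgD; first exact: cvg_cst.
  apply: cvgZr_tmp; exact: cvg_at_right_filter.
have Dsu : \forall t \near 0^'+, D v s (y t) = D v (u i) (y t).
  near=> t.
  have t0 : 0 < t by near: t; exact: nbhs_right_gt.
  have t1 : t < 1 by near: t; exact: nbhs_right_lt.
  pose k j := (1 - t) * l j + t * 3^-1.
  have yE : y t = \sum_j k j *: tri i j.
    rewrite /y /c xE -sumrB scaler_sumr -big_split; apply: eq_bigr => j _ /=.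
    by rewrite /k -scalerBl scalerA -scalerDl; congr (_ *: _); ring.
  have k0 j : 0 < k j.
    by rewrite ltr_wpDl ?mulr_ge0 ?divr_gt0 ?ltr0n// ?subr_ge0 ltW.
  have k1 : \sum_j k j = 1.
    by rewrite big_split/= -mulr_sumr l1 sum_I3; field.
  have Ty : \forall z \near y t, closed_triangle (tri i) z.
    by rewrite yE; apply: positive_closed_triangle.
  apply: D_near.
  have Oy : domain tri (y t).
    by apply: filterS Ty => z Tz; exists i.
  have Oz : \forall z \near y t, domain tri z.
    by apply: open_nbhs_nbhs; split => //; exact: open_interior.
  by near=> z; apply: su; near: z.
have lim1 : D v s (y t) @[t --> 0^'+] --> D v s x.
  exact: cvg_comp yx (Dsc x Ox).
have lim2 : D v s (y t) @[t --> 0^'+] --> D v (u i) x.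
  have lim3 : D v (u i) (y t) @[t --> 0^'+] --> D v (u i) x.
    have cu : {for x, continuous (D v (u i))}.
      exact: (is_poly_continuous (is_poly_derive v (uP i))).
    exact: cvg_comp yx cu.
  apply: cvg_trans lim3; apply: near_eq_cvg.
  by apply: filterS Dsu => t ->.
exact: cvg_unique lim1 lim2.
Unshelve. all: end_near. Qed.

End Smooth.

Section Splines.
Context {R : realType} (N : nat) (tri : 'I_N -> 'I_3 -> 'rV[R]_2).
Context (Htri : triangulation tri).
Local Notation plane := 'rV[R]_2.
Local Notation Omega := (domain tri).
Implicit Types (n d : nat) (s : plane -> R) (v : plane -> plane)
  (u : 'I_N -> plane -> R) (w : 'I_N -> plane -> plane).

Lemma Cr_grad n (U : set plane) s k : Cr n.+1 U s -> Cr n U (fun x => grad s x 0 k).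
Proof.
move=> /CrS[_ _ sx sy]; have [->|->] := ord2P k.
  by rewrite (_ : (fun x => _) = D ex s)//; apply/funext => x; rewrite grad00.
by rewrite (_ : (fun x => _) = D ey s)//; apply/funext => x; rewrite grad01.
Qed.

Lemma Cr_curl n (U : set plane) v : open U ->
  (forall k, Cr n.+1 U (fun x => v x 0 k)) -> Cr n U (curl v).
Proof.
move=> oU vC; have /CrS[_ _ v1x _] := vC 1; have /CrS[_ _ _ v0y] := vC 0.
rewrite (_ : curl v = fun x => D ex (fun y => v y 0 1) x
  - D ey (fun y => v y 0 0) x); first exact: CrB.
by apply/funext => x; rewrite curlE.
Qed.

Lemma agree_grad n d s u : Cr n.+1 Omega s -> (forall i, is_poly d (u i)) ->
  agree tri s u -> agree tri (grad s) (bgrad u).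
Proof.
move=> /CrS[_ _ sx sy] uP su i x Tx Ox.
have Ex := agree_D Htri (fun y => Cr_continuous sx) uP su Tx Ox.
have Ey := agree_D Htri (fun y => Cr_continuous sy) uP su Tx Ox.
by rewrite /bgrad !gradE Ex Ey.
Qed.

Lemma agree_curl n d v w : (forall k, Cr n.+1 Omega (fun x => v x 0 k)) ->
  (forall i, is_vpoly d (w i)) ->
  (forall k, agree tri (fun x => v x 0 k) (fun i x => w i x 0 k)) ->
  agree tri (curl v) (bcurl w).
Proof.
move=> vC wP vw i x Tx Ox.
have /CrS[_ _ v1x _] := vC 1; have /CrS[_ _ _ v0y] := vC 0.
have Ex := agree_D Htri (fun y => Cr_continuous v1x) (fun i => wP i 1) (vw 1) Tx Ox.
have Ey := agree_D Htri (fun y => Cr_continuous v0y) (fun i => wP i 0) (vw 0) Tx Ox.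
by rewrite /bcurl !curlE Ex Ey.
Qed.

Lemma vspline_bgrad n d u : spline tri n.+1 d u -> vspline tri n d.-1 (bgrad u).
Proof.
move=> [uP [s [sC su]]] k; split => [i|]; first exact: is_vpoly_grad.
exists (fun x => grad s x 0 k); split; first exact: Cr_grad.
by move=> i x Tx Ox; rewrite (agree_grad sC uP su Tx Ox).
Qed.

Lemma vspline_fun_grad n d s : spline_fun tri n.+1 d s ->
  vspline_fun tri n d.-1 (grad s).
Proof.
move=> [sC [u [uP su]]] k; split; first exact: Cr_grad.
exists (fun i x => bgrad u i x 0 k); split => [i|i x Tx Ox].
  exact: is_vpoly_grad.
by rewrite (agree_grad sC uP su Tx Ox).
Qed.

Lemma is_poly_bcurl k d w : vspline tri k d w -> forall i, is_poly d.-1 (bcurl w i).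
Proof. by move=> wS i; apply: is_poly_curl => l; have [wP _] := wS l. Qed.

Lemma spline_bcurl n d w : vspline tri n.+1 d w -> spline tri n d.-1 (bcurl w).
Proof.
move=> wS; split; first exact: is_poly_bcurl wS.
have [w0P [s0 [s0C s0w]]] := wS 0; have [w1P [s1 [s1C s1w]]] := wS 1.
pose v x : plane := s0 x *: ex + s1 x *: ey.
have v0 : (fun x => v x 0 0) = s0.
  by apply/funext => x; rewrite /v !mxE mulr1 mulr0 addr0.
have v1 : (fun x => v x 0 1) = s1.
  by apply/funext => x; rewrite /v !mxE mulr1 mulr0 add0r.
have vC k : Cr n.+1 Omega (fun x => v x 0 k).
  by have [->|->] := ord2P k; rewrite ?v0 ?v1.
exists (curl v); split; first exact: Cr_curl (@open_interior _ _) vC.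
apply: (agree_curl vC) => [i k|k]; last by have [->|->] := ord2P k; rewrite ?v0 ?v1.
by have [wP _] := wS k.
Qed.

Lemma spline_fun_curl n d v : vspline_fun tri n.+1 d v ->
  spline_fun tri n d.-1 (curl v).
Proof.
move=> vS; have vC k : Cr n.+1 Omega (fun x => v x 0 k) by have [] := vS k.
split; first exact: Cr_curl (@open_interior _ _) vC.
have [_ [u0 [u0P vu0]]] := vS 0; have [_ [u1 [u1P vu1]]] := vS 1.
pose w i x : plane := u0 i x *: ex + u1 i x *: ey.
have w0 i : (fun x => w i x 0 0) = u0 i.
  by apply/funext => x; rewrite /w !mxE mulr1 mulr0 addr0.
have w1 i : (fun x => w i x 0 1) = u1 i.
  by apply/funext => x; rewrite /w !mxE mulr1 mulr0 add0r.
have wP i : is_vpoly d (w i).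
  by move=> k; have [->|->] := ord2P k; rewrite ?w0 ?w1.
exists (bcurl w); split => [i|]; first exact: is_poly_curl.
apply: (agree_curl vC wP) => k i x Tx Ox.
have [->|->] := ord2P k.
  by rewrite -[RHS]/((fun x => w i x 0 0) x) w0 (vu0 i x).
by rewrite -[RHS]/((fun x => w i x 0 1) x) w1 (vu1 i x).
Qed.

End Splines.

Theorem theorem5p3 (R : realType) (N : nat) (tri : 'I_N -> 'I_3 -> 'rV[R]_2)
    (nE : nat) (src tgt : 'I_nE -> 'rV[R]_2) (Tp Tm : 'I_nE -> 'I_N)
    (r d : nat)
    (Htri : triangulation tri)
    (Hedges : interior_edges tri src tgt Tp Tm)
    (Hr : (1 <= r)%N) (Hd : (r + 1 <= d)%N) :
  (* gradient *)
  [/\ forall (i : 'I_N) (a b : 'rV[R]_2), edge (tri i) a b ->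
        Gamma_v (tri i) a b d.-1 r *m G_mx (tri i) d
        = B_mx a b r d *m Gamma_s (tri i) a b d r.+1,
      jump_v tri src tgt Tp Tm d.-1 r *m D0_mx tri d
        = B0_mx src tgt r d *m jump_s tri src tgt Tp Tm d r.+1 &
      forall s : 'rV[R]_2 -> R, spline_fun tri r d s ->
          vspline_fun tri r.-1 d.-1 (grad s)]
  /\
  (* curl *)
  [/\ forall (i : 'I_N) (a b : 'rV[R]_2), edge (tri i) a b ->
        Gamma_s (tri i) a b d.-2 r.-1 *m curl_mx (tri i) d.-1
        = Bcurl_mx a b r d *m Gamma_v (tri i) a b d.-1 r,
      jump_s tri src tgt Tp Tm d.-2 r.-1 *m D1_mx tri d.-1
        = B1_mx src tgt r d *m jump_v tri src tgt Tp Tm d.-1 r &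
      (2 <= r)%N -> forall v : 'rV[R]_2 -> 'rV[R]_2,
        vspline_fun tri r.-1 d.-1 v -> spline_fun tri r.-2 d.-2 (curl v)]
  /\
  (* subcomplex, in terms of the polynomial pieces *)
  [/\ forall u : 'I_N -> 'rV[R]_2 -> R, spline tri r%:Z d u ->
        vspline tri (r%:Z - 1) d.-1 (bgrad u),
      forall v : 'I_N -> 'rV[R]_2 -> 'rV[R]_2,
        vspline tri (r%:Z - 1) d.-1 v ->
        spline tri (r%:Z - 2) d.-2 (bcurl v) &
      forall u : 'I_N -> 'rV[R]_2 -> R, spline tri r%:Z d u ->
        forall (i : 'I_N) (x : 'rV[R]_2), bcurl (bgrad u) i x = 0]
  /\
  (* the piecewise operators are the restrictions of the classical ones *)
  [/\ forall (s : 'rV[R]_2 -> R) (u : 'I_N -> 'rV[R]_2 -> R),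
        Cr r (domain tri) s -> (forall i : 'I_N, is_poly d (u i)) ->
        agree tri s u -> agree tri (grad s) (bgrad u) &
      (2 <= r)%N -> forall (v : 'rV[R]_2 -> 'rV[R]_2)
          (w : 'I_N -> 'rV[R]_2 -> 'rV[R]_2),
        (forall k : 'I_2, Cr r.-1 (domain tri) (fun x => v x 0 k)) ->
        (forall i : 'I_N, is_vpoly d.-1 (w i)) ->
        agree tri v w -> agree tri (curl v) (bcurl w)].
Proof.
have [nd _ _ _] := Htri; have [He _ _] := Hedges.
case: r Hr Hd => // r _; rewrite addn1 => rd.
have r1 : r.+1%:Z - 1 = r by rewrite intS addrAC subrr add0r.
split; [split|split; [split|split; split]].
- by move=> i a b _; exact: Gamma_grad.
- by apply: jump_mx_blockdiag => e i _; exact: Gamma_grad.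
- by move=> s; exact: vspline_fun_grad.
- by move=> i a b ab; apply: Gamma_curl => //; exact: edge_neq ab.
- apply: jump_mx_blockdiag => e i ei; apply: Gamma_curl => //.
  by have [_ ep _] := He e; exact: edge_neq ep.
- by case: r {rd r1} => // r _ v; exact: spline_fun_curl.
- by move=> u; rewrite r1; exact: vspline_bgrad.
- move=> v; rewrite r1; case: r {rd r1} => [|r] vS.
    by split => // i; exact: is_poly_bcurl vS i.
  have -> : r.+2%:Z - 2 = r by lia.
  exact: spline_bcurl.
- by move=> u [uP _] i x; exact: curl_grad (uP i).
- by move=> s u sC uP; exact: agree_grad sC uP.
- case: r {rd r1} => // r _ v w vC wP vw.
  by apply: (agree_curl Htri vC wP) => k i x Tx Ox; rewrite (vw i x).
Qed.
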